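(* Let $M_R$ be a unitary right module over a commutative ring $R$ with $1$, and let $P=\{r\in R : Mr=0\}$. The topological ring $({\rm End}(M_R),\mathcal T_{fin})$ is completely simple if and only if the following conditions are satisfied: (a) $P$ is a prime ideal of $R$; (b) $M$ is a vector space over the field $K$ of fractions of $R/P$, and the $R$-endomorphisms of $M$ are exactly the $K$-linear transformations; (c) either (i) $M$ is finite, or (ii) $M$ is infinite and the dimension of $M$ over the field $K$ is infinite.
   Context: ${\rm End}(M_R)$ is the ring of all $R$-endomorphisms of $M$. The finite topology $\mathcal T_{fin}$ on it is the ring topology for which the sets $T(F)=\{\alpha\in {\rm End}(M_R) : \alpha(F)=0\}$, $F$ ranging over all finite subsets of $M$, form a fundamental system of neighborhoods of zero. Prime ideals are proper. A ring topology is a topology for which addition, negation and multiplication are (jointly) continuous; all topologies considered are assumed completely regular, in particular Hausdorff. A topological ring $(E,\mathcal T)$ is completely simple if $E^2\neq 0$ and for every continuous ring homomorphism $f:(E,\mathcal T)\to (S,\mathcal U)$ into a (Hausdorff) topological ring $(S,\mathcal U)$, either $\ker(f)=E$ or $f$ is a homeomorphism of $(E,\mathcal T)$ onto ${\rm Im}(f)$ with the subspace topology. In (b), ''$M$ is a vector space over $K$'' means that the additive group of $M$ carries a $K$-vector space structure with the stated property (in which $m\cdot (r+P)=mr$). *)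

(* Defs.v *)
From HB Require Import structures.
From mathcomp Require Import all_boot all_order all_algebra.
From mathcomp Require Import generic_quotient ring_quotient fraction.
From mathcomp Require Import all_classical.
From mathcomp Require Import topology pseudometric_normed_Zmodule tvs.

Set Implicit Arguments.
Unset Strict Implicit.
Unset Printing Implicit Defensive.

Import GRing.Theory.

Local Open Scope classical_set_scope.
Local Open Scope ring_scope.

(* Topological rings are associative, not necessarily unital, and Hausdorff.
   The multiplication is a separate operation [rmul], since the ring
   structures of the library all have a unit. *)
HB.mixin Record TopologicalZmodule_isTopRing E & TopologicalZmodule E := {
  rmul : E -> E -> E ;
  rmulA : associative rmul ;
  rmulDl : left_distributive rmul +%R ;
  rmulDr : right_distributive rmul +%R ;
  rmul_continuous : continuous (fun x : E * E => rmul x.1 x.2) ;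
  topring_hausdorff : hausdorff_space E ;
}.

#[short(type="topRingType")]
HB.structure Definition TopRing :=
  {E of TopologicalZmodule E & TopologicalZmodule_isTopRing E}.

Definition ring_hom (E S : topRingType) (f : E -> S) : Prop :=
  {morph f : x y / x + y} /\ {morph f : x y / rmul x y}.

(* Only the values of [g] on [range f], which carries the subspace topology,
   matter. *)
Definition homeo_onto_image (E S : topRingType) (f : E -> S) : Prop :=
  continuous f /\
  exists2 g : S -> E, cancel f g & {within range f, continuous g}.

Definition completely_simple (E : topRingType) : Prop :=
  (exists x y : E, rmul x y != 0) /\
  forall (S : topRingType) (f : E -> S), ring_hom f -> continuous f ->
    (forall x, f x = 0) \/ homeo_onto_image f.

(* Over a commutative ring, right modules are the same thing as left modules:
   [r *: m] stands for the product of [m] by [r] on the right. *)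
Definition endo (R : comPzRingType) (M : lmodType R) := {linear M -> M}.

Section Endo.
Variables (R : comPzRingType) (M : lmodType R).
Local Notation E := (endo M).
Implicit Types f g h : E.

HB.instance Definition _ := gen_eqMixin E.
HB.instance Definition _ := gen_choiceMixin E.

Definition endo_fun f : M -> M := f.

Lemma endoP f g : endo_fun f =1 endo_fun g -> f = g.
Proof.
move=> /funext; rewrite /endo_fun; case: f g => [f cf] [g cg] /= fg.
case: _ / fg cg => cg; congr GRing.Linear.Pack.
case: cf cg => [[a] [b]] [[c] [d]].
by rewrite (Prop_irrelevance a c) (Prop_irrelevance b d).
Qed.

Definition endo_zero : E := \0 : {linear M -> M}.
Definition endo_opp f : E := \- f : {linear M -> M}.
Definition endo_add f g : E := f \+ g : {linear M -> M}.
Definition endo_mul f g : E := f \o g : {linear M -> M}.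

Lemma endo_addA : associative endo_add.
Proof. by move=> f g h; apply: endoP => m; exact: addrA. Qed.

Lemma endo_addC : commutative endo_add.
Proof. by move=> f g; apply: endoP => m; exact: addrC. Qed.

Lemma endo_add0 : left_id endo_zero endo_add.
Proof. by move=> f; apply: endoP => m; exact: add0r. Qed.

Lemma endo_addN : left_inverse endo_zero endo_opp endo_add.
Proof. by move=> f; apply: endoP => m; exact: addNr. Qed.

HB.instance Definition _ :=
  GRing.isZmodule.Build E endo_addA endo_addC endo_add0 endo_addN.

Lemma endo_mulA : associative endo_mul.
Proof. by move=> f g h; apply: endoP. Qed.

Lemma endo_mulDl : left_distributive endo_mul +%R.
Proof. by move=> f g h; apply: endoP. Qed.

Lemma endo_mulDr : right_distributive endo_mul +%R.
Proof. by move=> f g h; apply: endoP => m; exact: raddfD. Qed.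

Definition annihilating (F : set M) : set E :=
  [set a | forall m, F m -> endo_fun a m = 0].

(* The finite topology: the sets [f + T(F)], [F] finite, are a base of
   neighborhoods of [f]. *)
Definition endo_nbhs f : set_system E :=
  filter_from [set F : set M | finite_set F]
              (fun F => [set f + a | a in annihilating F]).

HB.instance Definition _ := hasNbhs.Build E endo_nbhs.

Lemma endo_nbhsP f (U : set E) : nbhs f U <->
  exists2 F : set M, finite_set F &
    forall g, (forall m, F m -> endo_fun g m = endo_fun f m) -> U g.
Proof.
split=> -[F finF FU]; exists F => // g.
  move=> fg; apply: FU; exists (g - f); last by rewrite addrC subrK.
  by move=> m Fm /=; apply/eqP; rewrite subr_eq0; apply/eqP/fg.
move=> [a aF <-]; apply: FU => m Fm.
have -> : endo_fun (f + a) m = endo_fun f m + endo_fun a m by [].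
by rewrite aF// addr0.
Qed.

Lemma endo_nbhs_filter f : ProperFilter (nbhs f).
Proof.
apply: Build_ProperFilter_ex.
  by move=> U /endo_nbhsP[F _ FU]; exists f; exact: FU.
split.
- by apply/endo_nbhsP; exists set0.
- move=> U V /endo_nbhsP[F finF FU] /endo_nbhsP[G finG GV].
  apply/endo_nbhsP; exists (F `|` G); first by rewrite finite_setU.
  by move=> g fg; split; [apply: FU|apply: GV] => m Fm; apply: fg;
    [left|right].
- move=> U V UV /endo_nbhsP[F finF FU].
  by apply/endo_nbhsP; exists F => // g /FU/UV.
Qed.

Lemma endo_nbhs_singleton f (U : set E) : nbhs f U -> U f.
Proof. by move=> /endo_nbhsP[F _]; exact. Qed.

Lemma endo_nbhs_nbhs f (U : set E) : nbhs f U -> nbhs f (nbhs^~ U).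
Proof.
move=> /endo_nbhsP[F finF FU]; apply/endo_nbhsP; exists F => // g fg.
apply/endo_nbhsP; exists F => // h gh.
by apply: FU => m Fm; rewrite gh// fg.
Qed.

HB.instance Definition _ := Nbhs_isNbhsTopological.Build E
  endo_nbhs_filter endo_nbhs_singleton endo_nbhs_nbhs.

Lemma endo_sub_continuous : continuous (fun x : E * E => x.1 - x.2).
Proof.
move=> [f g] U /endo_nbhsP[F finF FU].
exists ([set h | forall m, F m -> endo_fun h m = endo_fun f m],
        [set h | forall m, F m -> endo_fun h m = endo_fun g m]).
  by split; apply/endo_nbhsP; exists F.
move=> [f' g'] [/= ff' gg']; apply: FU => m Fm.
by rewrite /endo_fun/= [X in X + _]ff'// [X in _ - X]gg'.
Qed.

HB.instance Definition _ :=
  PreTopologicalNmodule_isTopologicalZmodule.Build E endo_sub_continuous.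

Lemma endo_mul_continuous : continuous (fun x : E * E => endo_mul x.1 x.2).
Proof.
move=> [f g] U /endo_nbhsP[F finF FU].
exists ([set h | forall m, (endo_fun g @` F) m -> endo_fun h m = endo_fun f m],
        [set h | forall m, F m -> endo_fun h m = endo_fun g m]).
  split; apply/endo_nbhsP; last by exists F.
  by exists (endo_fun g @` F) => //; exact: finite_image.
move=> [f' g'] [/= ff' gg']; apply: FU => m Fm.
rewrite /endo_fun/= [X in f' X]gg'//.
by apply: ff'; exists m.
Qed.

Lemma endo_hausdorff : hausdorff_space E.
Proof.
move=> f g fg; apply: endoP => m.
have nb (h : E) : nbhs h [set k | endo_fun k m = endo_fun h m].
  by apply/endo_nbhsP; exists [set m] => // k; exact.
by have [k [/= <- <-]] := fg _ _ (nb f) (nb g).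
Qed.

HB.instance Definition _ := TopologicalZmodule_isTopRing.Build E
  endo_mulA endo_mulDl endo_mulDr endo_mul_continuous endo_hausdorff.

End Endo.

Record prime_ideal (R : comPzRingType) (I : set R) : Prop := PrimeIdeal {
  pideal0 : I 0 ;
  pidealD : forall x y, I x -> I y -> I (x + y) ;
  pidealM : forall a x, I x -> I (a * x) ;
  pideal_proper : I <> setT ;
  pideal_prime : forall x y, I (x * y) -> I x \/ I y
}.

(* The integral domain [R / I] and its field of fractions, for a prime ideal
   [I] of [R]. The library quotients a nonzero ring by a boolean predicate,
   whereas [R] may a priori be zero. *)
Section PrimeQuotient.
Variables (R : comPzRingType) (I : set R) (pI : prime_ideal I).

Lemma pideal1 : ~ I 1.
Proof.
move=> I1; apply: (pideal_proper pI); rewrite -subTset => x _.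
by rewrite -[x]mulr1; exact: (pidealM pI).
Qed.

Lemma pideal_oner_neq0 : 1 != 0 :> R.
Proof. by apply/eqP => e; apply: pideal1; rewrite e; exact: pideal0 pI. Qed.

Definition nonzero_ring : comNzRingType := HB.pack (GRing.ComPzRing.sort R)
  (GRing.PzSemiRing_isNonZero.Build R pideal_oner_neq0).

Definition pideal_pred : {pred nonzero_ring} := fun r => `[< I r >].

Lemma pideal_idealr_closed : idealr_closed pideal_pred.
Proof.
split; first exact/asboolP/(pideal0 pI).
  by apply/asboolP; exact: pideal1.
move=> a u v /asboolP Iu /asboolP Iv; apply/asboolP.
by apply: (pidealD pI) => //; exact: (pidealM pI).
Qed.

HB.instance Definition _ :=
  isIdealr.Build nonzero_ring pideal_pred pideal_idealr_closed.

Lemma pideal_prime_closed : prime_idealr_closed pideal_pred.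
Proof.
move=> u v /asboolP /(pideal_prime pI)[Iu|Iv]; apply/orP.
  by left; apply/asboolP.
by right; apply/asboolP.
Qed.

HB.instance Definition _ :=
  isPrimeIdealrClosed.Build nonzero_ring pideal_pred pideal_prime_closed.

Definition prime_quot := {ideal_quot pideal_pred}.

HB.instance Definition _ := GRing.ComNzRing.on prime_quot.

Definition pquot_unit : {pred prime_quot} :=
  fun x => `[< exists y, y * x = 1 >].

Definition pquot_inv (x : prime_quot) : prime_quot :=
  if pselect (exists y, y * x = 1) is left e then projT1 (cid e) else x.

Lemma pquot_mulVx : {in pquot_unit, left_inverse 1 pquot_inv *%R}.
Proof.
move=> x /asboolP xu; rewrite /pquot_inv; case: pselect => // e.
by case: cid.
Qed.

Lemma pquot_unitPl (x y : prime_quot) : y * x = 1 -> pquot_unit x.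
Proof. by move=> yx; apply/asboolP; exists y. Qed.

Lemma pquot_invr_out : {in [predC pquot_unit], pquot_inv =1 id}.
Proof.
move=> x /asboolP xu; rewrite /pquot_inv; by case: pselect.
Qed.

HB.instance Definition _ := GRing.ComNzRing_hasMulInverse.Build prime_quot
  pquot_mulVx pquot_unitPl pquot_invr_out.

Lemma pquot_integral (x y : prime_quot) : x * y = 0 -> (x == 0) || (y == 0).
Proof. exact: Quotient.rquot_IdomainAxiom. Qed.

HB.instance Definition _ :=
  GRing.ComUnitRing_isIntegral.Build prime_quot pquot_integral.

Definition residue_field : fieldType := {fraction prime_quot}.

(* The canonical map [r |-> (r + I) / 1]. *)
Definition to_residue_field (r : R) : residue_field :=
  @FracField.tofrac prime_quot (\pi_({ideal_quot pideal_pred})%qT r).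

End PrimeQuotient.

Definition module_annihilator (R : comPzRingType) (M : lmodType R) : set R :=
  [set r | forall m : M, r *: m = 0].

Record lmod_structure (K : pzRingType) (V : zmodType) := LmodStructure {
  lmod_scale : K -> V -> V ;
  lmod_scaleA : forall a b v,
    lmod_scale a (lmod_scale b v) = lmod_scale (a * b) v ;
  lmod_scale1 : left_id 1 lmod_scale ;
  lmod_scaleDr : right_distributive lmod_scale +%R ;
  lmod_scaleDl : forall v, {morph lmod_scale^~ v : a b / a + b}
}.

Definition lmod_of (K : pzRingType) (V : zmodType) (s : lmod_structure K V)
  : Type := V.

Section LmodOf.
Variables (K : pzRingType) (V : zmodType) (s : lmod_structure K V).

HB.instance Definition _ := GRing.Zmodule.on (lmod_of s).

HB.instance Definition _ := GRing.Zmodule_isLmodule.Build K (lmod_of s)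
  (lmod_scaleA s) (lmod_scale1 s) (lmod_scaleDr s) (lmod_scaleDl s).

End LmodOf.

Definition finite_dimensional (K : fieldType) (V : lmodType K) : Prop :=
  exists n : nat, inhabited (Vector.axiom n V).

(* Main.v *)
Require Import Defs.
From HB Require Import structures.
From mathcomp Require Import finmap.
From mathcomp Require Import all_boot all_algebra all_classical.
From mathcomp Require Import generic_quotient ring_quotient fraction.
From mathcomp Require Import topology tvs ring.

(** Let [E] be the endomorphism ring of [M] with the finite topology.

    Sufficiency. Let [M] be a vector space over a field [K], with the same
    endomorphisms, and [f] a nonzero continuous homomorphism from [E] to a
    topological ring. The kernel of [f] is a two-sided ideal; if it contains
    [a <> 0] then it contains, for every finite set [G], an endomorphism that
    fixes each element of [G] ([local_unit_in_kernel]), so it is dense, hence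
    everything since it is closed. Therefore [f] is injective. For the
    continuity of its inverse, fix a rank one [e]: some neighborhood [W] of 0
    misses [f e]. If [a] does not kill [m], then [e = b a c] where [c] depends
    on [m] alone and [b] only has to send [a m] to a given vector
    ([rank_one_factor]). If [f b] and [f (a c)] are both small, then [f e]
    falls into [W], a contradiction, so [f a] small forces [a m = 0]. When [M]
    is finite, finitely many [b] are enough. Otherwise continuity of [f] makes
    [f b] small as soon as [b] kills a suitable finite set [G], and such a [b]
    exists unless [a m] lies in the span of [G]. In infinite dimension a fixed
    linear map [d] moves the nonzero vectors of that span out of it
    ([displacing_map]), and then [d a] can be used in place of [a].

    Necessity. [E] acts continuously on every quotient [M / N] and on every
    submodule [N] stable under [E], and complete simplicity says that such an
    action is zero or faithful. Take [r] with [r M <> 0]. The action on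
    [M / M[r]], where [M[r]] is the kernel of [r], shows that the annihilator
    [P] is prime. The multiplication by [r] is nonzero but acts as zero on
    [M[r]] and on [M / r M], so both vanish: [r] acts bijectively on [M]. Hence
    [M] is a vector space over the field of fractions [K] of [R / P]. Suppose
    that [M] is infinite of finite dimension [n]; then [K] is infinite, and
    [E] is the discrete ring of the [n * n] matrices over [K]. The identity map
    to the same ring with a nondiscrete Hausdorff ring topology contradicts
    complete simplicity, and that topology comes, entrywise, from one on [K]
    ([infinite_field_base]).

    So every infinite field [K] must be given a nondiscrete Hausdorff ring
    topology. If [1 / t] is not an integral polynomial in [t] for some
    [t <> 0], then by Zorn's lemma there is a subring [A] that contains [t] and
    is maximal among those without [1 / t]; its field of fractions is [K]
    ([maximal_subring_fractions]), and the nonzero principal ideals of [A] form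
    a base at 0. Otherwise every nonzero [t] satisfies [t p(t) = 1] for an
    integral polynomial [p], so [K] is countable, and a decreasing base of
    neighborhoods [U n] is generated by a sequence [a] of nonzero elements
    chosen one after the other: each [a k] has to avoid the roots of finitely
    many nonzero polynomials in order to keep the [n]-th element of [K] out
    of [U n] ([avoids_extend]). *)

Set Implicit Arguments.
Unset Strict Implicit.
Unset Printing Implicit Defensive.

Import GRing.Theory.
Local Open Scope classical_set_scope.
Local Open Scope ring_scope.

(** * Homomorphisms of topological rings *)

Section TopRingTheory.
Variable S : topRingType.
Implicit Types (a x y : S) (U W : set S).

Lemma rmulr0 a : rmul a 0 = 0.
Proof. by apply: (addrI (rmul a 0)); rewrite -rmulDr !addr0. Qed.

Lemma rmul0r a : rmul 0 a = 0.
Proof. by apply: (addrI (rmul 0 a)); rewrite -rmulDl !addr0. Qed.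

Lemma nbhs0_rmul W : nbhs (0 : S) W ->
  exists2 V, nbhs (0 : S) V & forall x y, V x -> V y -> W (rmul x y).
Proof.
move=> W0; have : nbhs (rmul (0 : S) 0) W by rewrite rmulr0.
move/(@rmul_continuous S (0, 0)) => [[A B] [/= A0 B0] ABW].
exists (A `&` B); first exact: filterI.
by move=> x y [Ax _] [_ By]; exact: (ABW (x, y)).
Qed.

Lemma nbhs0_rmull a W : nbhs (0 : S) W -> nbhs (0 : S) [set x | W (rmul a x)].
Proof.
move=> W0; have : nbhs (rmul a 0) W by rewrite rmulr0.
move/(@rmul_continuous S (a, 0)) => [[A B] [/= A0 B0] ABW].
apply: filterS B0 => x Bx; apply: (ABW (a, x)); split => //=.
exact: nbhs_singleton A0.
Qed.

Lemma nbhs0_rmulr a W : nbhs (0 : S) W -> nbhs (0 : S) [set x | W (rmul x a)].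
Proof.
move=> W0; have : nbhs (rmul 0 a) W by rewrite rmul0r.
move/(@rmul_continuous S (0, a)) => [[A B] [/= A0 B0] ABW].
apply: filterS A0 => x Bx; apply: (ABW (x, a)); split => //=.
exact: nbhs_singleton B0.
Qed.

Lemma nbhs0_separates a : a != 0 -> exists2 W, nbhs (0 : S) W & ~ W a.
Proof.
move=> a0; apply: contrapT => noW; move/eqP: a0; apply.
apply: topring_hausdorff => A B Aa B0; exists a; split.
  exact: nbhs_singleton Aa.
by apply: contrapT => Ba; apply: noW; exists B.
Qed.

End TopRingTheory.

Section TopZmodTheory.
Variable S : topologicalZmodType.

Lemma nbhs_translate (x y : S) (U : set S) :
  nbhs x U -> nbhs (x + y) [set z | U (z - y)].
Proof.
move=> Ux; have : nbhs ((x + y) - y) U by rewrite addrK.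
move/(@sub_continuous S (x + y, y)) => [[A B] [/= A0 B0] ABU].
apply: filterS A0 => z Az; apply: (ABU (z, y)); split => //=.
exact: nbhs_singleton B0.
Qed.

End TopZmodTheory.

Section RingHom.
Variables (E S : topRingType) (f : E -> S).
Hypothesis fD : {morph f : x y / x + y}.

Lemma morph_add0 : f 0 = 0.
Proof. by apply: (addrI (f 0)); rewrite -fD !addr0. Qed.

Lemma morph_addB x y : f (x - y) = f x - f y.
Proof. by apply: (addIr (f y)); rewrite -fD !subrK. Qed.

Lemma morph_add_continuous :
  (forall U, nbhs (0 : S) U -> nbhs (0 : E) (f @^-1` U)) -> continuous f.
Proof.
move=> f0 x U Ufx.
have /f0/(nbhs_translate x) : nbhs (0 : S) [set y | U (y + f x)].
  have := nbhs_translate (- f x) Ufx; rewrite subrr.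
  by apply: filterS => y /=; rewrite opprK.
by rewrite add0r; apply: filterS => y /=; rewrite morph_addB subrK.
Qed.

(** Translations reduce the continuity of the inverse on the image to its
    continuity at 0. *)
Lemma homeo_onto_imageP : injective f -> continuous f ->
  homeo_onto_image f <-> forall U, nbhs (0 : E) U ->
    exists2 V, nbhs (0 : S) V & forall x, V (f x) -> U x.
Proof.
move=> finj fcont; split.
  move=> [_ [g fg /subspace_continuousP gcont]] U U0.
  have Ug : nbhs (g (f 0)) U by rewrite fg.
  have := gcont (f 0) (ex_intro2 _ _ 0 Logic.I erefl) U Ug.
  rewrite morph_add0 => gU.
  exists [set y | range f y -> U (g y)]; first exact: gU.
  by move=> x /= /(_ (ex_intro2 _ _ x Logic.I erefl)); rewrite fg.
move=> fopen; split => //.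
have [g gP] : exists g : S -> E, forall y, range f y -> f (g y) = y.
  have /choice[g gP] : forall y, exists x, range f y -> f x = y.
    move=> y; have [[x _ xy]|ny] := pselect (range f y); first by exists x.
    by exists 0.
  by exists g.
have fg : cancel f g by move=> x; apply: finj; apply: gP; exists x.
exists g => //; apply/subspace_continuousP => _ [x _ <-] U Ugf.
have Ux : nbhs x U by rewrite -[x]fg.
have /fopen[V V0 VU] : nbhs (0 : E) [set y | U (y + x)].
  have := nbhs_translate (- x) Ux; rewrite subrr.
  by apply: filterS => y /=; rewrite opprK.
have := nbhs_translate (f x) V0; rewrite add0r; apply: filterS.
move=> y Vy [z _ zy]; move: Vy; rewrite -zy /= -morph_addB => /VU /=.
by rewrite subrK -{1}[z]fg.
Qed.

End RingHom.

Section EndoTop.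
Variables (R : comPzRingType) (M : lmodType R).
Local Notation E := (endo M).

Lemma nbhs0_endoP (U : set E) : nbhs (0 : E) U <->
  exists s : seq M,
    forall a : E, (forall m, m \in s -> endo_fun a m = 0) -> U a.
Proof.
split.
  move=> /endo_nbhsP[F /finite_seqP[s sF] FU]; exists s => a as0.
  apply: FU => m; by rewrite sF => /as0 ->.
move=> [s sU]; apply/endo_nbhsP; exists [set` s]; first exact: finite_seq.
by move=> a as0; apply: sU => m /as0.
Qed.

Lemma filter_seq (T : eqType) (S : Type) (F : set_system S) (s : seq T)
    (A : T -> set S) : Filter F -> (forall x, x \in s -> F (A x)) ->
  F [set y | forall x, x \in s -> A x y].
Proof.
move=> FF; elim: s => [|x s IH] FA; first by apply: filterS filterT.
have Fs : F [set y | forall x, x \in s -> A x y].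
  by apply: IH => z zs; apply: FA; rewrite in_cons zs orbT.
have Fx : F (A x) by apply: FA; rewrite mem_head.
apply: filterS (filterI Fx Fs) => y [Axy Asy] z.
by rewrite in_cons => /predU1P[->//|/Asy].
Qed.

(** The inverse may be tested one vector at a time: finitely many
    neighborhoods can be intersected. Injectivity comes for free, as
    [f a = 0] lies in every neighborhood of 0. *)
Lemma endo_homeo (S : topRingType) (f : E -> S) : ring_hom f -> continuous f ->
  (forall m : M, exists2 V, nbhs (0 : S) V &
     forall a : E, V (f a) -> endo_fun a m = 0) ->
  homeo_onto_image f.
Proof.
move=> [fD fM] fcont fopen.
have finj : injective f.
  move=> a b fab; apply: endoP => m; apply/eqP; rewrite -subr_eq0; apply/eqP.
  have [V V0 Vm] := fopen m; apply: (Vm (a - b)).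
  by rewrite morph_addB// fab subrr; exact: nbhs_singleton.
apply/homeo_onto_imageP => // U /nbhs0_endoP[s sU].
have /choice[V VP] : forall m, exists V : set S, nbhs (0 : S) V /\
    forall a : E, V (f a) -> endo_fun a m = 0.
  by move=> m; have [V V0 Vm] := fopen m; exists V.
exists [set y | forall m, m \in s -> V m y].
  by apply: filter_seq => m _; have [] := VP m.
by move=> a Va; apply: sU => m /Va; have [_] := VP m; apply.
Qed.

Definition endo_of (h : M -> M) (hl : linear h) : E :=
  HB.pack h (GRing.isLinear.Build R M M *:%R h hl).

End EndoTop.

(** * Maximal closed sets and linear functionals *)

(** A single ternary relation stands for all the operations of an algebraic
    structure: [r x y z] means that [z] is one of the results that the
    operations give on [x] and [y]. Subspaces and subrings are both closed
    sets of this kind. *)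
Definition closed_under (T : Type) (r : T -> T -> T -> Prop) (A : set T) :=
  forall x y z, r x y z -> A x -> A y -> A z.

(** Zorn's lemma applies because an operation takes two arguments: both lie
    in one member of a chain. The chains are made of sets whose union with
    [L] is closed, so that the empty chain needs no special treatment. *)
Lemma maximal_closed_avoiding (T : Type) (r : T -> T -> T -> Prop) (L : set T)
    (m : T) : closed_under r L -> ~ L m ->
  exists A : set T, [/\ closed_under r A, L `<=` A, ~ A m &
    forall C, closed_under r C -> A `<=` C -> ~ C m -> C `<=` A].
Proof.
move=> clL Lm.
pose P : set (set T) := [set A | closed_under r (A `|` L) /\ ~ (A `|` L) m].
have chainP (F : set (set T)) : F `<=` P -> total_on F subset ->
    P (\bigcup_(X in F) X).
  move=> FP Ftot; split; last first.
    by move=> [[X FX Xm]|//]; have [_] := FP _ FX; apply; left.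
  have common x y : (\bigcup_(X in F) X `|` L) x ->
      (\bigcup_(X in F) X `|` L) y ->
      (L x /\ L y) \/ exists2 X, F X & (X `|` L) x /\ (X `|` L) y.
    move=> [[X FX Xx]|Lx] [[Y FY Yy]|Ly]; [|right|right|by left].
    - right; have [XY|YX] := Ftot _ _ FX FY.
        by exists Y => //; split; left => //; exact: XY.
      by exists X => //; split; left => //; exact: YX.
    - by exists X => //; split; [left|right].
    - by exists Y => //; split; [right|left].
  move=> x y z rxyz Ux Uy; have [[Lx Ly]|[X FX [Xx Xy]]] := common _ _ Ux Uy.
    by right; exact: clL Lx Ly.
  have [clX _] := FP _ FX; have [Xz|Lz] := clX _ _ _ rxyz Xx Xy.
    by left; exists X.
  by right.
have [A [[clA Am] Amax]] := Zorn_bigcup chainP.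
exists (A `|` L); split => //.
move=> C clC AC Cm; apply: contrapT => CA.
have LC : C `|` L = C by apply/setUidPl => x Lx; apply: AC; right.
apply: (Amax C); last by split; rewrite LC.
split=> [x Ax|CsA]; first by apply: AC; left.
by apply: CA => x /CsA; left.
Qed.

Section Functional.
Variables (K : fieldType) (V : lmodType K).

Definition is_subspace (L : set V) :=
  L 0 /\ forall c x y, L x -> L y -> L (x + c *: y).

(** A subspace [A] maximal among those that contain [L] and avoid [m] is a
    hyperplane complementary to the line of [m]; the functional reads the
    coordinate along [m]. *)
Lemma separating_functional (L : set V) (m : V) : is_subspace L -> ~ L m ->
  exists phi : V -> K,
    [/\ linear (phi : V -> K^o), forall x, L x -> phi x = 0 & phi m = 1].
Proof.
move=> [L0 LL] Lm; pose r (x y z : V) := exists c, z = x + c *: y.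
have clP A : closed_under r A <-> forall c x y, A x -> A y -> A (x + c *: y).
  split=> [clA c x y Ax Ay|clA x y _ [c ->]]; last exact: clA.
  by apply: (clA x y) => //; exists c.
have [A [/clP clA LA Am Amax]] :=
  maximal_closed_avoiding ((clP L).2 LL) Lm.
have A0 := LA _ L0.
(* Existence of the coordinate: if [x] is not in [A], then adding [x] to [A]
   yields [m], by maximality. *)
have dec x : exists c, A (x - c *: m).
  have [Ax|Ax] := pselect (A x); first by exists 0; rewrite scale0r subr0.
  pose C : set V := [set y | exists c, A (y + c *: x)].
  have clC : closed_under r C.
    apply/clP => c y z [d Ay] [e Az]; exists (d + c * e).
    by rewrite scalerDl -scalerA addrACA -scalerDr; exact: clA.
  have AC : A `<=` C by move=> y Ay; exists 0; rewrite scale0r addr0.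
  have [d Amd] : C m.
    apply: contrapT => Cm; apply: Ax; apply: (Amax _ clC AC Cm).
    by exists (-1); rewrite scaleN1r subrr.
  have d0 : d != 0.
    by apply/eqP => d0; move: Amd; rewrite d0 scale0r addr0.
  exists (- d^-1); rewrite -[X in A X]add0r.
  have -> : x - - d^-1 *: m = d^-1 *: (m + d *: x).
    by rewrite scaleNr opprK scalerDr scalerA mulVf// scale1r addrC.
  exact: clA.
have uniq x c d : A (x - c *: m) -> A (x - d *: m) -> c = d.
  move=> Ac Ad; apply/eqP; rewrite -subr_eq0; apply/negPn/negP => cd0.
  apply: Am.
  have := clA (- 1) _ _ Ad Ac; rewrite scaleN1r opprB addrC addrA subrK.
  rewrite -scalerBl => Acd.
  by have := clA (c - d)^-1 _ _ A0 Acd; rewrite scalerA mulVf// scale1r add0r.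
pose phi x := projT1 (cid (dec x)).
have phiP x : A (x - phi x *: m) by rewrite /phi; case: cid.
exists phi; split.
- move=> c x y /=; apply: (@uniq (c *: x + y)); first exact: phiP.
  rewrite /= scalerDl opprD addrACA addrC -[(_ * _) *: m]scalerA -scalerBr.
  by apply: clA; exact: phiP.
- move=> x Lx; apply: (@uniq x); first exact: phiP.
  by rewrite scale0r subr0; exact: LA.
- by apply: (@uniq m); [exact: phiP|rewrite scale1r subrr].
Qed.

End Functional.

(** * Finite spans in a vector space *)

Section Span.
Variables (K : fieldType) (V : lmodType K).

Fixpoint lspan (G : seq V) : set V :=
  if G is g :: G' then [set x | exists c, lspan G' (x - c *: g)] else [set 0].

Lemma subspace_lspan G : is_subspace (lspan G).
Proof.
elim: G => [|g G [IH0 IH]] /=.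
  by split=> // c _ _ -> ->; rewrite scaler0 addr0.
split=> [|c x y [a xa] [b yb]]; first by exists 0; rewrite scale0r subr0.
exists (a + c * b).
rewrite scalerDl opprD addrACA -scalerA -scalerBr; exact: IH.
Qed.

Lemma lspan_cons g G x : lspan G x -> lspan (g :: G) x.
Proof. by exists 0; rewrite scale0r subr0. Qed.

Lemma mem_lspan G g : g \in G -> lspan G g.
Proof.
elim: G => //= h G IH; rewrite in_cons => /predU1P[->|/IH].
  by exists 1; rewrite scale1r subrr; have [] := subspace_lspan G.
exact: lspan_cons.
Qed.

Lemma lspan_catl G H x : lspan G x -> lspan (G ++ H) x.
Proof.
elim: G x => [x -> | g G IH x [c xc]] /=; first by have [] := subspace_lspan H.
by exists c; exact: IH.
Qed.

Lemma lspan_catr G H x : lspan H x -> lspan (G ++ H) x.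
Proof. by elim: G => // g G IH /IH; exact: lspan_cons. Qed.

Lemma lspan_map (f : V -> V) G x : linear f -> lspan G x ->
  lspan [seq f g | g <- G] (f x).
Proof.
move=> lf; elim: G x => [x -> | g G IH x [c xc]] /=.
  have := lf (-1) 0 0; rewrite scaleN1r oppr0 addr0 scaleN1r addrC subrr.
  by move=> ->.
exists c; have <- : f (x - c *: g) = f x - c *: f g; last exact: IH.
by rewrite addrC -scaleNr lf scaleNr addrC.
Qed.

Lemma lspan_parametrization G : exists n (p : 'rV[K]_n -> V), linear p /\
  forall x, lspan G x -> exists v, p v = x.
Proof.
elim: G => [|g G [n [p [lp pG]]]].
  exists 0%N, (fun=> 0); split; first by move=> c v w /=; rewrite scaler0 addr0.
  by move=> x ->; exists 0.
exists (1 + n)%N, (fun w : 'rV_(1 + n) => w 0 0 *: g + p (rsubmx w)); split.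
  move=> c v w /=; rewrite linearP lp !mxE scalerDl scalerDr -scalerA.
  by rewrite addrACA.
move=> x [c /pG[v pv]]; exists (row_mx c%:M v).
have j0 : lshift n (0 : 'I_1) = 0 by exact: val_inj.
by rewrite row_mxKr pv -j0 row_mxEl mxE eqxx mulr1n addrC subrK.
Qed.

(** While the surjection has a nonzero [v] in its kernel, say with a nonzero
    [j]-th coordinate, every vector is the image of a row whose [j]-th entry is
    0, so that the number of coordinates can be lowered. *)
Lemma surjection_finite_dimensional n (p : 'rV[K]_n -> V) : linear p ->
  (forall x, exists v, p v = x) -> finite_dimensional V.
Proof.
elim: n p => [|n IH] p lp psurj.
  have /choice[q qP] := psurj; exists 0%N; split.
  exists q; first by move=> c v w; rewrite !thinmx0.
  by exists p => // v; rewrite !thinmx0.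
have [inj|] := pselect (forall v, p v = 0 -> v = 0).
  have /choice[q qP] := psurj.
  have pB v w : p v = p w -> v = w.
    move=> pvw; apply/eqP; rewrite -subr_eq0; apply/eqP/inj.
    by rewrite addrC -scaleN1r lp pvw scaleN1r addrC subrr.
  exists n.+1; split; exists q; last by exists p => // v; exact: pB.
  by move=> c v w; apply: pB; rewrite lp !qP.
move=> /existsNP[v /not_implyP[pv0 /eqP/rV0Pn[j vj]]].
pose e (w : 'rV[K]_n) : 'rV[K]_n.+1 :=
  \row_i (if unlift j i is Some k then w 0 k else 0).
have le : linear e.
  move=> c x y; apply/rowP => i; rewrite !mxE.
  by case: unlift => [k|]; rewrite ?mxE// mulr0 addr0.
apply: (IH (p \o e)).
  by move=> c x y /=; rewrite le lp.
move=> x; have [w wx] := psurj x.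
exists (\row_k (w 0 (lift j k) - w 0 j / v 0 j * v 0 (lift j k))) => /=.
have -> : e (\row_k (w 0 (lift j k) - w 0 j / v 0 j * v 0 (lift j k))) =
    - (w 0 j / v 0 j) *: v + w.
  apply/rowP => i; rewrite !mxE; case: unliftP => [k ->|->].
    by rewrite mxE mulNr addrC.
  by rewrite mulNr -mulrA mulVf// mulr1 addNr.
by rewrite lp pv0 scaler0 add0r.
Qed.

Lemma infinite_dimensional_lspan G : ~ finite_dimensional V ->
  exists u, ~ lspan G u.
Proof.
move=> Vinf; apply: contrapT => /forallNP Gall; apply: Vinf.
have [n [p [lp pG]]] := lspan_parametrization G.
apply: (surjection_finite_dimensional lp) => x.
by apply: pG; apply: contrapT; exact: Gall.
Qed.

(** The map is built one generator [g] at a time: since the dimension is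
    infinite, [g] can be sent outside the span of [G0] and of the images of
    the previous generators. *)
Lemma displacing_map G0 G : ~ finite_dimensional V -> exists2 f : V -> V,
  linear f & forall x, lspan G x -> lspan G0 (f x) -> x = 0.
Proof.
move=> Vinf; elim: G => [|g G [f lf fG]].
  by exists id => // x ->.
have [Gg|Gg] := pselect (lspan G g).
  exists f => // x [c xc]; apply: fG.
  have [_ sG] := subspace_lspan G.
  by have := sG c _ _ xc Gg; rewrite subrK.
have [phi [lphi phi0 phi1]] := separating_functional (subspace_lspan G) Gg.
have [u Hu] := infinite_dimensional_lspan (G0 ++ [seq f g | g <- G]) Vinf.
exists (fun x => f (x - phi x *: g) + phi x *: u).
  move=> c x y; rewrite lphi/= scalerDl opprD addrACA -scalerA -scalerBr lf.
  by rewrite scalerDl scalerDr addrACA scalerA.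
move=> x [c xc] /=.
have phix : phi x = c.
  have := lphi c g (x - c *: g).
  rewrite [_ + (x - _)]addrC subrK phi1 (phi0 _ xc) => ->.
  by rewrite -[RHS]mulr1 -[RHS]addr0.
rewrite phix => Hx.
have c0 : c = 0.
  apply/eqP/negPn/negP => c0; apply: Hu.
  have [H0 sH] := subspace_lspan (G0 ++ [seq f g | g <- G]).
  have := sH (-1) _ _ (lspan_catl [seq f g | g <- G] Hx)
    (lspan_catr G0 (lspan_map lf xc)).
  rewrite scaleN1r addrAC subrr add0r => Hcu.
  by have := sH c^-1 _ _ H0 Hcu; rewrite add0r scalerA mulVf// scale1r.
by move: xc Hx; rewrite c0 !scale0r subr0 addr0; exact: fG.
Qed.

End Span.

(** * Endomorphism rings of vector spaces are completely simple *)

Section VectorSpace.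
Variables (R : comPzRingType) (M : lmodType R) (K : fieldType).
Variable s : lmod_structure K M.
Local Notation V := (lmod_of s).
Local Notation E := (endo M).
Hypothesis linE : forall f : M -> M, linear f <-> linear (f : V -> V).

Lemma endo_exists (f : V -> V) : linear f -> exists a : E, endo_fun a = f.
Proof. by move=> /linE lf; exists (endo_of lf). Qed.

Lemma line_map (phi : V -> K) (u : V) : linear (phi : V -> K^o) ->
  exists a : E, forall x, endo_fun a x = phi x *: u.
Proof.
move=> lphi; have [|a aE] := @endo_exists (fun x => phi x *: u).
  by move=> c x y; rewrite lphi scalerDl scalerA.
by exists a => x; rewrite aE.
Qed.

Lemma endo_scale (a : E) (c : K) (u : V) :
  endo_fun a (c *: u) = c *: (endo_fun a u : V) :> V.
Proof.
have la : linear (endo_fun a : V -> V) by apply/linE; exact: linearP.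
have a0 : endo_fun a 0 = 0 by exact: linear0.
by have := la c u 0; rewrite a0 !addr0.
Qed.

Lemma is_subspace0 : is_subspace ([set 0] : set V).
Proof. by split => // c _ _ -> ->; rewrite scaler0 addr0. Qed.

Lemma endo_separating (L : set V) (m u : V) : is_subspace L -> ~ L m ->
  exists2 a : E, endo_fun a m = u & forall x, L x -> endo_fun a x = 0.
Proof.
move=> sL Lm; have [phi [lphi phi0 phi1]] := separating_functional sL Lm.
have [a aE] := line_map u lphi; exists a; first by rewrite aE phi1 scale1r.
by move=> x Lx; rewrite aE phi0// scale0r.
Qed.

Lemma endo_transitive (m u : M) : m != 0 -> exists a : E, endo_fun a m = u.
Proof.
move=> /eqP m0; have [a am _] := @endo_separating [set 0] m u is_subspace0 m0.
by exists a.
Qed.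

Section Hom.
Variables (S : topRingType) (f : E -> S).
Hypothesis fhom : ring_hom f.
Hypothesis fcont : continuous f.

Let fD : {morph f : x y / x + y} := fhom.1.
Let fM : {morph f : x y / endo_mul x y >-> rmul x y} := fhom.2.
Let f0 : f 0 = 0 := morph_add0 fD.

(** The kernel contains a rank one [r] that fixes any prescribed vector, since
    [a] can be composed on both sides. If [p] already fixes [G] and [r] fixes
    [g - p g], then [p + r - r p], that is [1 - (1 - r) (1 - p)], fixes [G]
    and [g]. *)
Lemma local_unit_in_kernel (a : E) : a != 0 -> f a = 0 -> forall G : seq M,
  exists2 p : E, f p = 0 & forall m, m \in G -> endo_fun p m = m.
Proof.
move=> a0 fa0; have [m am] : exists m, endo_fun a m != 0.
  apply: contrapT => nm; move/eqP: a0; apply; apply: endoP => m.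
  by apply/eqP/negPn/negP => am; apply: nm; exists m.
elim=> [|g G [p fp pG]]; first by exists 0.
pose g' := g - endo_fun p g.
have [g'0|g'0] := eqVneq g' 0.
  exists p => // h; rewrite in_cons => /predU1P[->|/pG//].
  by apply/esym/eqP; rewrite -subr_eq0; apply/eqP.
have [b bg'] := endo_transitive m g'0; have [c ca] := endo_transitive g' am.
pose r := endo_mul c (endo_mul a b).
have fr : f r = 0 by rewrite !fM fa0 rmul0r rmulr0.
have rE x : endo_fun r x = endo_fun c (endo_fun a (endo_fun b x)) by [].
exists (p + (r - endo_mul r p)).
  by rewrite fD morph_addB// fM fp fr rmulr0 subr0 addr0.
move=> h hG; have -> : endo_fun (p + (r - endo_mul r p)) h =
      endo_fun p h + endo_fun r (h - endo_fun p h).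
  by rewrite [endo_fun r _]raddfB.
move: hG; rewrite in_cons => /predU1P[->|/pG ->].
  by rewrite -/g' rE bg' ca addrC subrK.
by rewrite subrr [endo_fun r 0]raddf0 addr0.
Qed.

(** Every [x] is a limit of elements [x p] of the kernel, where [p] fixes more
    and more vectors. *)
Lemma hom_zero_or_injective :
  (forall x, f x = 0) \/ (forall x, f x = 0 -> x = 0).
Proof.
have [|/existsNP[a /not_implyP[fa /eqP a0]]] :=
  pselect (forall x, f x = 0 -> x = 0); first by right.
left=> x; apply: topring_hausdorff => A B Ax B0.
have /endo_nbhsP[F /finite_seqP[G ->] GA] := fcont Ax.
have [p fp pG] := local_unit_in_kernel a0 fa G.
have fxp : f (endo_mul x p) = 0 by rewrite fM fp rmulr0.
exists 0; split; last exact: nbhs_singleton B0.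
rewrite -fxp; apply: (GA (endo_mul x p)) => m mG.
by rewrite -[LHS]/(endo_fun x (endo_fun p m)) pG.
Qed.

Section Homeo.
Hypothesis finj : forall x, f x = 0 -> x = 0.
Variable e0 : M.
Hypothesis e0_neq0 : e0 != 0.

(** With [phi e0 = 1], the rank one maps [e x = phi x e0] and
    [c x = phi x m] satisfy [e = b a c] as soon as [b (a m) = e0]. *)
Lemma rank_one_factor : exists W : set S, [/\ nbhs (0 : S) W &
   forall m : M, exists c : E, forall a b : E,
     endo_fun b (endo_fun a m) = e0 -> ~ W (rmul (f b) (rmul (f a) (f c)))].
Proof.
have /eqP e0' := e0_neq0.
have [phi [lphi _ phi1]] := separating_functional (is_subspace0) e0'.
have [e eE] := line_map e0 lphi.
have fe : f e != 0.
  apply/eqP => /finj e_0; move/eqP: e0_neq0; apply.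
  have : 1 *: (e0 : V) = 0 by rewrite -phi1 -eE e_0.
  by rewrite scale1r.
have [W W0 We] := nbhs0_separates fe; exists W; split => // m.
have [c cE] := line_map m lphi; exists c => a b abm; rewrite -!fM.
suff -> : endo_mul b (endo_mul a c) = e by [].
apply: endoP => x; rewrite eE -[LHS]/(endo_fun b (endo_fun a (endo_fun c x))).
by rewrite cE !endo_scale abm.
Qed.

Lemma homeo_of_finite : finite_set [set: M] -> homeo_onto_image f.
Proof.
move=> /finite_seqP[G GE]; apply: endo_homeo => // m.
have [W [W0 WP]] := rank_one_factor; have [c cP] := WP m.
have /choice[b bP] : forall w : M, exists b : E, w != 0 -> endo_fun b w = e0.
  move=> w; have [->|w0] := eqVneq w 0; first by exists 0 => /eqP.
  by have [b bw] := endo_transitive e0 w0; exists b.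
exists [set y | forall w, w \in G -> W (rmul (f (b w)) (rmul y (f c)))].
  apply: (filter_seq
    (A := fun w => [set y | W (rmul (f (b w)) (rmul y (f c)))])) => w _.
  exact: (nbhs0_rmulr (f c) (nbhs0_rmull (f (b w)) W0)).
move=> a Wa; apply/eqP/negPn/negP => am.
apply: (cP a (b (endo_fun a m)) (bP _ am)); apply: Wa.
by have : [set: M] (endo_fun a m) by []; rewrite GE.
Qed.

(** Either [a m] or [d (a m)] is outside the span of [G], because [d] moves
    the nonzero vectors of that span out of it; the [b] that sends this vector
    to [e0] can then be chosen to kill [G], so that [f b] is small. *)
Lemma homeo_of_infinite_dimensional : ~ finite_dimensional V ->
  homeo_onto_image f.
Proof.
move=> Vinf; apply: endo_homeo => // m.
have [W [W0 WP]] := rank_one_factor; have [c cP] := WP m.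
have [U U0 UW] := nbhs0_rmul W0.
have /nbhs0_endoP[G GU] : nbhs (0 : E) (f @^-1` U).
  by apply: fcont; rewrite f0.
have [sg lsg sgP] := @displacing_map _ V G G Vinf.
have [d dE] := endo_exists lsg.
exists [set y | U (rmul y (f c)) /\ U (rmul (rmul (f d) y) (f c))].
  apply: filterI; first exact: nbhs0_rmulr.
  exact: (nbhs0_rmull (f d) (nbhs0_rmulr (f c) U0)).
move=> a [Ua Uda]; apply/eqP/negPn/negP => am.
(* The contradiction, for any [a'] that sends [m] outside the span of [G]. *)
have far (a' : E) : ~ @lspan K V G (endo_fun a' m) -> ~ U (rmul (f a') (f c)).
  move=> a'm Ua'.
  have [b bm b0] := endo_separating e0 (@subspace_lspan K V G) a'm.
  apply: (cP a' b bm); apply: UW => //.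
  by apply: GU => g gG; apply: b0; exact: mem_lspan.
have [Gam|Gam] := pselect (@lspan K V G (endo_fun a m)); last exact: (far a).
apply: (far (endo_mul d a)); last by rewrite fM.
move=> Gdam; move/eqP: am; apply; apply: sgP => //.
by rewrite -dE.
Qed.

End Homeo.
End Hom.

Lemma completely_simple_endo : (exists m : M, m != 0) ->
  finite_set [set: M] \/ ~ finite_dimensional V -> completely_simple E.
Proof.
move=> [m m0] finM; split.
  have [a am] := endo_transitive m m0; exists a, a; apply/eqP => aa0.
  move/eqP: m0; apply; rewrite -[LHS]am -[in LHS]am.
  by rewrite -[LHS]/(endo_fun (endo_mul a a) m) [endo_mul a a]aa0.
move=> S f fhom fcont.
have [|finj] := hom_zero_or_injective fhom fcont; [by left|right].
case: finM; first exact: homeo_of_finite m0.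
exact: homeo_of_infinite_dimensional m0.
Qed.

End VectorSpace.

(** * Invariant submodules and the rings acting on them *)

(** Stability under the whole endomorphism ring is what makes the ring act on
    the submodule and on the quotient. *)
Definition invariant_submodule (R : comPzRingType) (M : lmodType R) (N : set M)
  : Prop :=
  [/\ N 0, forall r x y, N x -> N y -> N (r *: x + y) &
      forall (a : endo M) x, N x -> N (endo_fun a x)].

Section Invariant.
Variables (R : comPzRingType) (M : lmodType R) (N : set M).
Hypothesis iN : invariant_submodule N.

Definition submod_pred of invariant_submodule N : {pred M} :=
  fun x => `[< N x >].
Local Notation P := (submod_pred iN).

Lemma submod_pred_closed : submod_closed P.
Proof.
have [N0 NL _] := iN; split; first exact/asboolP.
by move=> r x y /asboolP Nx /asboolP Ny; apply/asboolP; exact: NL.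
Qed.

HB.instance Definition _ := GRing.isSubmodClosed.Build R M P submod_pred_closed.

Definition submodule := {x : M | x \in P}.
HB.instance Definition _ := [isSub of submodule for @sval M _].
HB.instance Definition _ := [Choice of submodule by <:].
HB.instance Definition _ := [SubChoice_isSubLmodule of submodule by <:].

Lemma submod_predP x : reflect (N x) (x \in P).
Proof. exact: asboolP. Qed.

Lemma restrict_subproof (a : endo M) (x : submodule) : endo_fun a (val x) \in P.
Proof. by have [_ _ Na] := iN; apply/submod_predP/Na/submod_predP/valP. Qed.

Definition restrict_fun (a : endo M) (x : submodule) : submodule :=
  Sub (endo_fun a (val x)) (restrict_subproof a x).

Lemma restrict_linear a : linear (restrict_fun a).
Proof. by move=> r x y; apply: val_inj; rewrite /= [LHS]linearP. Qed.

Definition restrict (a : endo M) : endo submodule := endo_of (restrict_linear a).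

Lemma restrictE a x : val (endo_fun (restrict a) x) = endo_fun a (val x).
Proof. by []. Qed.

Lemma restrict_hom : ring_hom restrict.
Proof. by split=> a b; apply: endoP => x; exact: val_inj. Qed.

Lemma restrict_continuous : continuous restrict.
Proof.
apply: morph_add_continuous; first by case: restrict_hom.
move=> U /nbhs0_endoP[s sU]; apply/nbhs0_endoP; exists [seq val x | x <- s].
move=> a as0; apply: sU => x xs; apply: val_inj; rewrite restrictE.
by rewrite as0// map_f.
Qed.

Definition quotmod := Quotient.quot P.
HB.instance Definition _ := GRing.Zmodule.on quotmod.
Local Notation pi := (\pi_quotmod)%qT.

Lemma quotmod_eq x y : (pi x == pi y) = (x - y \in P).
Proof. by rewrite -Quotient.idealrBE. Qed.

Definition quot_scale (r : R) (q : quotmod) : quotmod := pi (r *: repr q).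

Lemma pi_scale r x : quot_scale r (pi x) = pi (r *: x).
Proof.
apply/eqP; rewrite quotmod_eq -scalerBr; apply: rpredZ.
by rewrite -quotmod_eq reprK.
Qed.

Lemma pi_add x y : pi x + pi y = pi (x + y).
Proof. by rewrite !piE. Qed.

Lemma pi_eq0 x : pi x = 0 :> quotmod <-> N x.
Proof.
have -> : 0 = pi 0 :> quotmod by rewrite piE.
split=> [/eqP|Nx]; last apply/eqP; rewrite quotmod_eq subr0.
  by move/submod_predP.
exact/submod_predP.
Qed.

Lemma quot_scaleA r t q : quot_scale r (quot_scale t q) = quot_scale (r * t) q.
Proof. by elim/quotW: q => x; rewrite (pi_scale t) !pi_scale scalerA. Qed.

Lemma quot_scale1 : left_id 1 quot_scale.
Proof. by elim/quotW=> x; rewrite pi_scale scale1r. Qed.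

Lemma quot_scaleDr : right_distributive quot_scale +%R.
Proof.
move=> r; elim/quotW=> x; elim/quotW=> y.
by rewrite pi_add !pi_scale pi_add scalerDr.
Qed.

Lemma quot_scaleDl q : {morph quot_scale^~ q : r t / r + t}.
Proof. by move=> r t; elim/quotW: q => x; rewrite !pi_scale pi_add scalerDl. Qed.

HB.instance Definition _ := GRing.Zmodule_isLmodule.Build R quotmod
  quot_scaleA quot_scale1 quot_scaleDr quot_scaleDl.

Definition induced_fun (a : endo M) (q : quotmod) : quotmod :=
  pi (endo_fun a (repr q)).

Lemma induced_pi a x :
  induced_fun a (pi x) = pi (endo_fun a x).
Proof.
apply/eqP; rewrite quotmod_eq -[X in X \in _]/(_ - _) -[_ - _]raddfB.
have [_ _ Na] := iN; apply/submod_predP/Na/submod_predP.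
by rewrite -quotmod_eq reprK.
Qed.

Lemma induced_linear a : linear (induced_fun a).
Proof.
move=> r; elim/quotW=> x; elim/quotW=> y.
have scaleE z : r *: (pi z : quotmod) = pi (r *: z) by exact: pi_scale.
rewrite scaleE pi_add !induced_pi scaleE pi_add.
by congr (pi _); rewrite [LHS]linearP.
Qed.

Definition induced (a : endo M) : endo quotmod := endo_of (induced_linear a).

Lemma inducedE a x : endo_fun (induced a) (pi x) =
  pi (endo_fun a x).
Proof. exact: induced_pi. Qed.

Lemma induced_hom : ring_hom induced.
Proof.
split=> a b; apply: endoP; elim/quotW=> x; rewrite inducedE.
  rewrite -[RHS]/(endo_fun (induced a) _ + endo_fun (induced b) _).
  by rewrite !inducedE pi_add.
rewrite -[RHS]/(endo_fun (induced a) (endo_fun (induced b) _)).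
by rewrite (inducedE b) (inducedE a).
Qed.

Lemma induced_continuous : continuous induced.
Proof.
apply: morph_add_continuous; first by case: induced_hom.
move=> U /nbhs0_endoP[s sU]; apply/nbhs0_endoP; exists [seq repr x | x <- s].
move=> a as0; apply: sU => q qs; rewrite -[q in LHS]reprK inducedE.
by rewrite as0 ?map_f// piE.
Qed.

End Invariant.

(** * Homotheties when the endomorphism ring is completely simple *)

Section Simple.
Variables (R : comPzRingType) (M : lmodType R).
Local Notation E := (endo M).
Local Notation P := (module_annihilator M).
Hypothesis simpleE : completely_simple E.

Lemma completely_simple_hom (S : topRingType) (f : E -> S) :
  ring_hom f -> continuous f ->
  (forall x, f x = 0) \/ (forall x, f x = 0 -> x = 0).
Proof.
move=> fhom fcont; have [|[_ [g fg _]]] := simpleE.2 S f fhom fcont.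
  by left.
right=> x fx; have [fD _] := fhom.
by rewrite -[x]fg fx -(morph_add0 fD) fg.
Qed.

Lemma homothety_linear (r : R) : linear (fun m : M => r *: m).
Proof. by move=> c x y; rewrite scalerDr !scalerA mulrC. Qed.

Definition homothety (r : R) : E := endo_of (homothety_linear r).

Lemma homothety_eq0 r : homothety r = 0 <-> P r.
Proof.
split=> [r0 m|Pr]; last by apply: endoP => m; exact: Pr.
by rewrite -[LHS]/(endo_fun (homothety r) m) r0.
Qed.

Lemma annihilator_neq0 : ~ P 1.
Proof.
move=> P1; have [[a [b /eqP ab]] _] := simpleE; apply: ab; apply: endoP => m.
by rewrite -[LHS]scale1r P1.
Qed.

Lemma torsion_invariant (r : R) : invariant_submodule [set m : M | r *: m = 0].
Proof.
split=> [|c x y /= rx ry|a x /= rx]; first exact: scaler0.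
  by rewrite scalerDr scalerA mulrC -scalerA rx ry scaler0 addr0.
by rewrite -[LHS]linearZ rx [LHS]linear0.
Qed.

Lemma image_invariant (r : R) :
  invariant_submodule [set m : M | exists x, m = r *: x].
Proof.
split=> [|c _ _ [x ->] [y ->]|a _ [x ->]]; first by exists 0; rewrite scaler0.
  by exists (c *: x + y); rewrite scalerDr !scalerA mulrC.
by exists (endo_fun a x); rewrite [LHS]linearZ.
Qed.

(** If [x y] kills [M] then [y] maps [M] into the kernel of [x], so it acts as
    zero on the quotient by that kernel. This quotient is nonzero when [x] does
    not kill [M], hence [E] acts faithfully on it and [y] kills [M]. *)
Lemma annihilator_prime : prime_ideal P.
Proof.
split.
- by move=> m; exact: scale0r.
- by move=> x y Px Py m; rewrite scalerDl Px Py addr0.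
- by move=> a x Px m; rewrite -scalerA Px scaler0.
- by move=> PT; apply: annihilator_neq0; rewrite PT.
- move=> x y Pxy; have [Px|/existsNP[m xm]] := pselect (P x); [by left|right].
  have iN := torsion_invariant x.
  have [all0|inj] := completely_simple_hom (induced_hom iN)
    (@induced_continuous _ _ _ iN).
    case: xm; apply/(pi_eq0 iN); rewrite -[m]scale1r.
    by rewrite -(inducedE iN (homothety 1) m) all0.
  apply/homothety_eq0/inj/endoP; elim/quotW=> z; rewrite inducedE.
  by apply/pi_eq0; change (x *: (y *: z) = 0); rewrite scalerA Pxy.
Qed.

(** The homothety of ratio [r] is nonzero and acts as zero on the kernel of
    [r], on which the action of [E] is therefore zero, including that of 1. *)
Lemma nonannihilator_inj r (m : M) : ~ P r -> r *: m = 0 -> m = 0.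
Proof.
move=> Pr rm; have iN := torsion_invariant r.
have [all0|inj] := completely_simple_hom (restrict_hom iN)
  (@restrict_continuous _ _ _ iN).
  have mP : m \in submod_pred iN by apply/submod_predP.
  have := restrictE (homothety 1) (Sub m mP : submodule iN).
  by rewrite all0 /= -[RHS]/(1 *: m) scale1r => <-.
case: Pr; apply/homothety_eq0/inj/endoP => x; apply: val_inj.
by have /submod_predP := valP x.
Qed.

(** The same argument, on the quotient of [M] by [r M]. *)
Lemma nonannihilator_surj r (m : M) : ~ P r -> exists x, m = r *: x.
Proof.
move=> Pr; have iN := image_invariant r.
have [all0|inj] := completely_simple_hom (induced_hom iN)
  (@induced_continuous _ _ _ iN).
  apply/(pi_eq0 iN); rewrite -[m]scale1r.
  by rewrite -(inducedE iN (homothety 1) m) all0.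
case: Pr; apply/homothety_eq0/inj/endoP; elim/quotW=> z; rewrite inducedE.
by apply/pi_eq0; exists z.
Qed.

End Simple.

(** * The vector space structure over the residue field *)

Section ResidueField.
Variables (R : comPzRingType) (I : set R) (pI : prime_ideal I).
Local Notation F := (residue_field pI).
Local Notation toF := (to_residue_field pI).
Local Notation Q := {ideal_quot (@pideal_pred R I pI)}.
Local Notation pi r := (\pi_Q (r : nonzero_ring pI))%qT.

Lemma to_residue_fieldD : {morph toF : x y / x + y}.
Proof.
move=> x y; rewrite /to_residue_field -tofracD; congr (FracField.tofrac _).
by rewrite -[RHS]/(pi x + pi y) piE.
Qed.

Lemma to_residue_fieldM : {morph toF : x y / x * y}.
Proof.
move=> x y; rewrite /to_residue_field -tofracM; congr (FracField.tofrac _).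
by rewrite -[RHS]/(pi x * pi y) piE.
Qed.

Lemma to_residue_field1 : toF 1 = 1.
Proof.
rewrite /to_residue_field -[RHS]tofrac1; congr (FracField.tofrac _).
by rewrite piE.
Qed.

Lemma to_residue_field_eq0 r : toF r = 0 <-> I r.
Proof.
have piP : pi r = 0 :> prime_quot pI <-> I r.
  have <- : pi 0 = 0 :> prime_quot pI by rewrite piE.
  split=> [/eqP|Ir]; last apply/eqP; rewrite -Quotient.idealrBE subr0.
    by move/asboolP.
  exact/asboolP.
rewrite -piP; split=> [/eqP|r0].
  by rewrite tofrac_eq0 => /eqP.
by rewrite /to_residue_field r0 tofrac0.
Qed.

Lemma residue_field_fraction (k : F) :
  exists r t, ~ I t /\ k * toF t = toF r.
Proof.
have [x [y [y0 kxy]]] : exists x y : prime_quot pI, y != 0 /\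
    k * FracField.tofrac y = FracField.tofrac x.
  elim/quotW: k => z; exists (frac z).1, (frac z).2; split.
    exact: denom_ratioP.
  unlock FracField.tofrac; rewrite -[LHS]FracField.pi_mul.
  apply/eqmodP; rewrite /= FracField.equivfE /FracField.mulf /=.
  rewrite !numden_Ratio ?mulf_neq0 ?oner_eq0 ?denom_ratioP//.
  by rewrite !mulr1 mulrC.
exists (repr x), (repr y); split.
  move=> /to_residue_field_eq0/eqP; rewrite tofrac_eq0 reprK.
  by apply/negP.
by rewrite /to_residue_field !reprK.
Qed.

End ResidueField.

Section FieldAction.
Variables (R : comPzRingType) (M : lmodType R).
Local Notation P := (module_annihilator M).
Variable pP : prime_ideal P.
Local Notation F := (residue_field pP).
Local Notation toF := (to_residue_field pP).
Hypothesis div_inj : forall r (m : M), ~ P r -> r *: m = 0 -> m = 0.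
Hypothesis div_surj : forall r (m : M), ~ P r -> exists x, m = r *: x.

Lemma div_eq r (x y : M) : ~ P r -> r *: x = r *: y -> x = y.
Proof.
move=> Pr xy; apply/eqP; rewrite -subr_eq0; apply/eqP/(div_inj Pr).
by rewrite scalerBr xy subrr.
Qed.

(** The fraction [k = r0 / t0] acts by [t0 x = r0 m]. Any other
    representation [r / t] differs from it by [r t0 - r0 t] in [P], which kills
    [m]. *)
Lemma fraction_scale_exists (k : F) (m : M) : exists x : M,
  forall r t, k * toF t = toF r -> t *: x = r *: m.
Proof.
have [r0 [t0 [Pt0 kE]]] := residue_field_fraction k.
have [x xE] := div_surj (r0 *: m) Pt0; exists x => r t kt.
apply: (div_eq Pt0); rewrite scalerA mulrC -scalerA -xE !scalerA.
have : toF (r * t0 - r0 * t) = 0.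
  apply: (addIr (toF (r0 * t))); rewrite -to_residue_fieldD subrK add0r.
  by rewrite !to_residue_fieldM -kt -kE mulrAC.
move=> /to_residue_field_eq0 /(_ m); rewrite scalerBl => /eqP.
by rewrite subr_eq0 mulrC [t * r0]mulrC => /eqP ->.
Qed.

Definition fraction_scale (k : F) (m : M) : M :=
  projT1 (cid (fraction_scale_exists k m)).

Lemma fraction_scaleP k m r t : k * toF t = toF r ->
  t *: fraction_scale k m = r *: m.
Proof. by rewrite /fraction_scale; case: cid => x /= /[apply]. Qed.

Lemma fraction_scale_to r m : fraction_scale (toF r) m = r *: m.
Proof.
have := @fraction_scaleP (toF r) m r 1; rewrite to_residue_field1 mulr1 scale1r.
exact.
Qed.

Lemma fraction_scaleA a b m :
  fraction_scale a (fraction_scale b m) = fraction_scale (a * b) m.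
Proof.
have [r [t [Pt aE]]] := residue_field_fraction a.
have [r' [t' [Pt' bE]]] := residue_field_fraction b.
have Ptt : ~ P (t * t') by case/(pideal_prime pP).
apply: (div_eq Ptt).
rewrite (@fraction_scaleP (a * b) m (r * r')); last first.
  by rewrite !to_residue_fieldM -aE -bE mulrACA.
rewrite [t * t']mulrC -[LHS]scalerA (fraction_scaleP _ aE) scalerA.
rewrite [t' * r]mulrC -[LHS]scalerA.
by rewrite (fraction_scaleP _ bE) scalerA.
Qed.

Lemma fraction_scale1 : left_id 1 fraction_scale.
Proof. by move=> m; rewrite -to_residue_field1 fraction_scale_to scale1r. Qed.

Lemma fraction_scaleDr : right_distributive fraction_scale +%R.
Proof.
move=> k x y; have [r [t [Pt kE]]] := residue_field_fraction k.
by apply: (div_eq Pt); rewrite scalerDr !(fraction_scaleP _ kE) scalerDr.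
Qed.

Lemma fraction_scaleDl m : {morph fraction_scale^~ m : a b / a + b}.
Proof.
move=> a b; have [r [t [Pt aE]]] := residue_field_fraction a.
have [r' [t' [Pt' bE]]] := residue_field_fraction b.
have Ptt : ~ P (t * t') by case/(pideal_prime pP).
apply: (div_eq Ptt).
rewrite (@fraction_scaleP (a + b) m (r * t' + r' * t)); last first.
  rewrite to_residue_fieldD !to_residue_fieldM -aE -bE mulrDl mulrA.
  by congr (_ + _); rewrite -!mulrA [_ * toF t']mulrC.
rewrite scalerDr scalerDl; congr (_ + _).
  by rewrite [t * t']mulrC -[RHS]scalerA (fraction_scaleP _ aE) scalerA mulrC.
by rewrite -[RHS]scalerA (fraction_scaleP _ bE) scalerA mulrC.
Qed.

Definition fraction_structure : lmod_structure F M :=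
  LmodStructure fraction_scaleA fraction_scale1 fraction_scaleDr fraction_scaleDl.

Lemma fraction_structureE r (m : M) :
  toF r *: (m : lmod_of fraction_structure) = r *: m.
Proof. exact: fraction_scale_to. Qed.

Lemma fraction_structure_linear (f : M -> M) : linear f <->
  linear (f : lmod_of fraction_structure -> lmod_of fraction_structure).
Proof.
split=> lf c x y; last first.
  by have := lf (toF c) x y; rewrite !fraction_structureE.
have [r [t [Pt cE]]] := residue_field_fraction c.
have fZ a z : f (a *: z) = a *: f z.
  have := lf a z 0; have := lf 1 0 0; rewrite !scale1r !addr0 => /eqP.
  rewrite -subr_eq0 opprD addrA subrr sub0r oppr_eq0 => /eqP ->.
  by rewrite addr0.
have fDD u v : f (u + v) = f u + f v by have := lf 1 u v; rewrite !scale1r.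
have -> : f (c *: (x : lmod_of fraction_structure) + y) =
  f (fraction_scale c x) + f y by rewrite -fDD.
congr (_ + _); apply: (div_eq Pt).
by rewrite -fZ (fraction_scaleP _ cE) fZ [RHS](fraction_scaleP _ cE).
Qed.

End FieldAction.

(** * Ring topologies given by a base at zero *)

(** The usual conditions for a family [B] of sets to be a base of
    neighborhoods of 0 for a Hausdorff ring topology. *)
Record zero_base (A : pzRingType) (B : set_system A) : Prop := ZeroBase {
  zbase_ex : exists U, B U ;
  zbaseI : forall U V, B U -> B V -> exists2 W, B W & W `<=` U `&` V ;
  zbase0 : forall U, B U -> U 0 ;
  zbaseB : forall U, B U ->
    exists2 V, B V & forall x y, V x -> V y -> U (x - y) ;
  zbaseM : forall U, B U ->
    exists2 V, B V & forall x y, V x -> V y -> U (x * y) ;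
  zbaseMl : forall a U, B U -> exists2 V, B V & forall x, V x -> U (a * x) ;
  zbaseMr : forall a U, B U -> exists2 V, B V & forall x, V x -> U (x * a) ;
  zbase_sep : forall x, x != 0 -> exists2 U, B U & ~ U x
}.

Lemma mulrB_split (A : pzRingType) (a b c d : A) :
  a * b - c * d = (a - c) * (b - d) + (a - c) * d + c * (b - d).
Proof. by rewrite -mulrDr subrK mulrBr mulrBl addrA subrK. Qed.

(** A copy of [A] that carries the topology of base [B], so that this
    structure does not interfere with those of [A] itself. *)
Definition base_ring (A : pzRingType) (B : set_system A) (hB : zero_base B)
  : Type := A.

Section BaseRing.
Variables (A : pzRingType) (B : set_system A) (hB : zero_base B).
Local Notation S := (base_ring hB).

HB.instance Definition _ := GRing.Zmodule.on S.

Definition base_nbhs (x : S) : set_system S :=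
  filter_from B (fun U => [set y : S | U (y - x)]).

HB.instance Definition _ := hasNbhs.Build S base_nbhs.

Lemma base_nbhs_filter (x : S) : ProperFilter (nbhs x).
Proof.
apply: filter_from_proper; last first.
  by move=> U BU; exists x; rewrite /= subrr; exact: zbase0 BU.
apply: filter_from_filter; first exact: zbase_ex hB.
move=> U V BU BV; have [W BW WUV] := zbaseI hB BU BV.
by exists W => // y /WUV.
Qed.

Lemma base_nbhs_singleton (x : S) (U : set S) : nbhs x U -> U x.
Proof. by move=> [V BV]; apply; rewrite /= subrr; exact: zbase0 BV. Qed.

Lemma base_nbhs_nbhs (x : S) (U : set S) : nbhs x U -> nbhs x (nbhs^~ U).
Proof.
move=> [V BV VU]; have [W BW WV] := zbaseB hB BV.
have [W' BW' W'V] := zbaseB hB BW.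
exists W' => // y W'y; exists W' => // z W'z; apply: VU => /=.
have -> : z - x = (z - y) - (0 - (y - x)) :> A.
  by rewrite sub0r opprK addrA subrK.
apply: WV; first by rewrite -[z - y]subr0; apply: W'V => //; exact: zbase0 BW'.
by apply: W'V => //; exact: zbase0 BW'.
Qed.

HB.instance Definition _ := Nbhs_isNbhsTopological.Build S
  base_nbhs_filter base_nbhs_singleton base_nbhs_nbhs.

Lemma base_sub_continuous : continuous (fun x : S * S => x.1 - x.2).
Proof.
move=> [x y] U [V BV VU]; have [W BW WV] := zbaseB hB BV.
exists ([set z : S | W (z - x)], [set z : S | W (z - y)]).
  by split; exists W.
move=> [z t] [/= Wz Wt]; apply: VU => /=.
have -> : z - t - (x - y) = (z - x) - (t - y) :> A.
  by rewrite !opprB [y - x]addrC addrACA [- t + y]addrC.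
exact: WV.
Qed.

HB.instance Definition _ :=
  PreTopologicalNmodule_isTopologicalZmodule.Build S base_sub_continuous.

Definition base_mul (x y : S) : S := (x : A) * y.

Lemma zbaseD U : B U -> exists2 V, B V & forall x y, V x -> V y -> U (x + y).
Proof.
move=> BU; have [V BV VU] := zbaseB hB BU; have [W BW WV] := zbaseB hB BV.
have W0 := zbase0 hB BW.
exists W => // x y Wx Wy; rewrite -[y]opprK -[- y]sub0r; apply: VU.
  by rewrite -[x]subr0; exact: WV.
exact: WV.
Qed.

Lemma base_mul_continuous : continuous (fun x : S * S => base_mul x.1 x.2).
Proof.
move=> [x y] U [V BV VU]; have [W BW WV] := zbaseD BV.
have [X BX XW] := zbaseD BW.
have [Y BY YX] := zbaseM hB BX.
have [L BL LW] := zbaseMl hB x BW.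
have [T BT TX] := zbaseMr hB y BX.
have [Z BZ ZYL] := zbaseI hB BY BL; have [Z' BZ' ZYT] := zbaseI hB BY BT.
exists ([set z : S | Z' (z - x)], [set z : S | Z (z - y)]).
  by split; [exists Z'|exists Z].
move=> [z t] [/= /ZYT[Yz Tz] /ZYL[Yt Lt]]; apply: VU => /=; rewrite /base_mul.
have -> : (z : A) * t - (x : A) * y =
    (z - x : A) * (t - y : A) + (z - x : A) * y + (x : A) * (t - y : A).
  exact: mulrB_split.
by apply: WV; [apply: XW; [exact: YX|exact: TX]|exact: LW].
Qed.

Lemma base_hausdorff : hausdorff_space S.
Proof.
move=> x y xy; apply/eqP; rewrite -subr_eq0; apply/negPn/negP => xy0.
have [U BU Uxy] := zbase_sep hB xy0; have [V BV VU] := zbaseB hB BU.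
have [z []] : [set z : S | V (z - y)] `&` [set z : S | V (z - x)] !=set0.
  by rewrite setIC; apply: xy; exists V.
move=> /= Vzy Vzx; apply: Uxy.
suff -> : x - y = (z - y) - (z - x) :> A by exact: VU.
by rewrite opprB [RHS]addrC addrA subrK.
Qed.

HB.instance Definition _ := @TopologicalZmodule_isTopRing.Build S
  base_mul (@mulrA A) (@mulrDl A) (@mulrDr A) base_mul_continuous
  base_hausdorff.

End BaseRing.

Section MatrixBase.
Variables (K : comPzRingType) (B : set_system K) (hB : zero_base B) (n : nat).

(** A base at 0 of the product topology. *)
Definition matrix_base : set_system 'M[K]_n :=
  [set [set A : 'M[K]_n | forall i j, U (A i j)] | U in B].

Lemma zbase_sum k U : B U -> exists2 V, B V &
  forall x : 'I_k -> K, (forall i, V (x i)) -> U (\sum_i x i).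
Proof.
elim: k U => [|k IH] U BU.
  by exists U => // x _; rewrite big_ord0; exact: zbase0 BU.
have [V BV VU] := zbaseD hB BU; have [W BW WV] := IH _ BV.
have [X BX XVW] := zbaseI hB BV BW.
exists X => // x Xx; rewrite big_ord_recl; apply: VU.
  by have [] := XVW _ (Xx ord0).
by apply: WV => i; have [] := XVW _ (Xx (lift ord0 i)).
Qed.

Lemma zbaseMl_seq (s : seq K) U : B U ->
  exists2 V, B V & forall a x, a \in s -> V x -> U (a * x).
Proof.
move=> BU; elim: s => [|a s [V BV VU]]; first by exists U.
have [W BW WU] := zbaseMl hB a BU; have [X BX XVW] := zbaseI hB BV BW.
exists X => // b x; rewrite in_cons => /predU1P[->|bs] /XVW[] Vx Wx.
  exact: WU.
exact: VU.
Qed.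

Lemma matrix_zbaseMl (C : 'M[K]_n) U : B U -> exists2 V, B V &
  forall A : 'M[K]_n, (forall i j, V (A i j)) ->
  forall i j, U ((C *m A) i j).
Proof.
move=> BU; have [V BV VU] := zbase_sum n BU.
have [W BW WV] := zbaseMl_seq [seq C p.1 p.2 | p : 'I_n * 'I_n] BV.
exists W => // A AW i j; rewrite mxE; apply: VU => k; apply: WV => //.
by apply/mapP; exists (i, k); rewrite ?mem_enum.
Qed.

Lemma matrix_zero_base : zero_base matrix_base.
Proof.
split.
- by have [U BU] := zbase_ex hB; exists [set A : 'M_n | forall i j, U (A i j)];
    exists U.
- move=> _ _ [U BU <-] [V BV <-]; have [W BW WUV] := zbaseI hB BU BV.
  exists [set A : 'M_n | forall i j, W (A i j)]; first by exists W.
  by move=> A AW; split=> i j; have [] := WUV _ (AW i j).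
- by move=> _ [U BU <-] i j; rewrite mxE; exact: zbase0 BU.
- move=> _ [U BU <-]; have [V BV VU] := zbaseB hB BU.
  exists [set A : 'M_n | forall i j, V (A i j)]; first by exists V.
  by move=> A C AV CV i j; rewrite !mxE; exact: VU.
- move=> _ [U BU <-]; have [V BV VU] := zbase_sum n BU.
  have [W BW WV] := zbaseM hB BV.
  exists [set A : 'M_n | forall i j, W (A i j)]; first by exists W.
  by move=> A C AW CW i j; rewrite mxE; apply: VU => k; exact: WV.
- move=> C _ [U BU <-]; have [V BV VU] := matrix_zbaseMl C BU.
  by exists [set A : 'M_n | forall i j, V (A i j)] => //; exists V.
- move=> C _ [U BU <-]; have [V BV VU] := matrix_zbaseMl C^T BU.
  exists [set A : 'M_n | forall i j, V (A i j)]; first by exists V.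
  move=> A AV i j; have trAC : (A *m C) i j = (C^T *m A^T) j i.
    by rewrite -trmx_mul [RHS]mxE.
  change (U ((A *m C) i j)); rewrite trAC.
  by apply: VU => k l; rewrite mxE.
- move=> A A0; have [i [j Aij]] : exists i j, A i j != 0.
    apply: contrapT => AA; move/eqP: A0; apply; apply/matrixP => i j.
    rewrite mxE; apply/eqP/negPn/negP => Aij; apply: AA; by exists i, j.
  have [U BU UA] := zbase_sep hB Aij.
  by exists [set A : 'M_n | forall i j, U (A i j)]; [exists U|move=> /(_ i j)].
Qed.

End MatrixBase.

(** * Nondiscrete ring topologies from a subring *)

Definition nondiscrete (A : pzRingType) (B : set_system A) :=
  forall U, B U -> exists2 u, U u & u != 0.

Definition subring (K : fieldType) (A : set K) : Prop :=
  [/\ A 1, forall x y, A x -> A y -> A (x - y) &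
      forall x y, A x -> A y -> A (x * y)].

Section Subring.
Variables (K : fieldType) (A : set K).
Hypothesis sA : subring A.

Definition ideal_base : set_system K :=
  [set [set a * x | x in A] | a in [set a | A a /\ a != 0]].

(** Scaling by an arbitrary [x] of [K] is continuous because [x] has a
    denominator in [A]; the topology is Hausdorff because [x] is not in the
    ideal generated by [b x t], where [b x] is in [A]: otherwise [t] would be
    invertible in [A]. *)
Lemma ideal_zero_base (t : K) : A t -> t != 0 -> ~ A t^-1 ->
  (forall x, exists2 b, A b /\ b != 0 & A (b * x)) -> zero_base ideal_base.
Proof.
have [A1 AB AM] := sA.
move=> At t0 AtV fracA; have A0 : A 0 by rewrite -(subrr 1); exact: AB.
have sc a U : ideal_base U ->
    exists2 V, ideal_base V & forall x, V x -> U (a * x).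
  move=> [c [Ac c0] <-]; have [b [Ab b0] Aba] := fracA a.
  exists [set b * c * x | x in A].
    by exists (b * c) => //; split; [exact: AM|rewrite mulf_neq0].
  move=> _ [x Ax <-]; exists (b * a * x); first exact: AM.
  by ring.
split=> //.
- by exists [set 1 * x | x in A]; exists 1 => //; split; rewrite ?oner_eq0.
- move=> _ _ [a [Aa a0] <-] [b [Ab b0] <-].
  exists [set a * b * x | x in A].
    by exists (a * b) => //; split; [exact: AM|rewrite mulf_neq0].
  move=> _ [x Ax <-]; split.
    by exists (b * x); [exact: AM|rewrite mulrA].
  by exists (a * x); [exact: AM|rewrite mulrA [b * a]mulrC].
- by move=> _ [a _ <-]; exists 0 => //; rewrite mulr0.
- move=> _ [a [Aa a0] <-]; exists [set a * x | x in A]; first by exists a.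
  move=> _ _ [x Ax <-] [y Ay <-]; exists (x - y); first exact: AB.
  by rewrite mulrBr.
- move=> _ [a [Aa a0] <-]; exists [set a * x | x in A]; first by exists a.
  move=> _ _ [x Ax <-] [y Ay <-]; exists (x * (a * y)).
    by apply: (AM) => //; exact: AM.
  by rewrite mulrA.
- move=> a U /(sc a)[V BV VU]; exists V => // x /VU; by rewrite mulrC.
- move=> x x0; have [b [Ab b0] Abx] := fracA x.
  exists [set (b * x * t) * y | y in A].
    by exists (b * x * t) => //; split; [exact: AM|rewrite !mulf_neq0].
  move=> [y Ay xE]; apply: AtV; have -> : t^-1 = b * y; last exact: AM.
  apply: (mulfI t0); rewrite divff//; apply: (mulfI x0).
  by rewrite mulr1 -[LHS]xE; ring.
Qed.

Lemma ideal_nondiscrete : nondiscrete ideal_base.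
Proof.
have [A1 _ _] := sA.
by move=> _ [a [Aa a0] <-]; exists a => //; exists 1; rewrite ?mulr1.
Qed.

End Subring.

Section SubringType.
Variables (K : fieldType) (A : set K) (sA : subring A).

Definition subring_pred : {pred K} := fun x => `[< A x >].

Lemma subring_pred_closed : subring_closed subring_pred.
Proof.
case: sA => A1 AB AM; split; first exact/asboolP.
  by move=> x y /asboolP Ax /asboolP Ay; apply/asboolP; exact: AB.
by move=> x y /asboolP Ax /asboolP Ay; apply/asboolP; exact: AM.
Qed.

HB.instance Definition _ :=
  GRing.isSubringClosed.Build K subring_pred subring_pred_closed.

Definition subring_type := {x : K | x \in subring_pred}.
HB.instance Definition _ := [isSub of subring_type for @sval K _].
HB.instance Definition _ := [Choice of subring_type by <:].
HB.instance Definition _ := [SubChoice_isSubComNzRing of subring_type by <:].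

Definition subring_val (a : subring_type) : K := val a.
HB.instance Definition _ := GRing.RMorphism.copy subring_val
  (val : {rmorphism subring_type -> K}).

Lemma size_map_subring_val (p : {poly subring_type}) :
  (size (map_poly subring_val p) <= size p)%N.
Proof. exact: size_poly. Qed.

Lemma horner_subring_val (p : {poly subring_type}) (z : K) : p != 0 ->
  (map_poly subring_val p).[z] = subring_val (lead_coef p) * z ^+ (size p).-1 +
    \sum_(i < (size p).-1) subring_val p`_i * z ^+ i.
Proof.
rewrite (horner_coef_wide _ (size_map_subring_val p)) lead_coefE.
rewrite -size_poly_gt0; case: (size p) => // m _.
rewrite big_ord_recr addrC coef_map; congr (_ + _).
by apply: eq_bigr => i _; rewrite coef_map.
Qed.

Lemma subring_valP (x : K) : A x -> exists a, subring_val a = x.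
Proof. by move=> /asboolP Ax; exists (exist _ x Ax). Qed.

Lemma subring_val_in a : A (subring_val a).
Proof. exact/asboolP/(valP a). Qed.

Lemma subring_sum n (F : 'I_n -> K) : (forall i, A (F i)) -> A (\sum_i F i).
Proof.
move=> AF; apply/asboolP; apply: (rpred_sum (S := subring_pred)) => i _.
exact/asboolP.
Qed.

(** Integrality stated with coefficients in [K] that belong to [A], rather than
    with polynomials over the subtype [subring_type]. *)
Definition integral_over (z : K) : Prop := exists n (c : 'I_n -> K),
  (forall i, A (c i)) /\ z ^+ n = \sum_i c i * z ^+ i.

Lemma integral_overP (z : K) : integral_over z <-> integralOver subring_val z.
Proof.
split.
  move=> [n [c [Ac zE]]].
  have /(_ _)/cid/= c' i := subring_valP (Ac i).
  exists ('X^n -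
    \poly_(i < n) (if insub i is Some j then projT1 (c' j) else 0)).
    rewrite monicE lead_coefDl ?lead_coefXn//.
    by rewrite size_polyN size_polyXn ltnS size_poly.
  rewrite /root rmorphB /= map_polyXn hornerD hornerN hornerXn zE subr_eq0.
  apply/eqP; rewrite (@horner_coef_wide _ n); last first.
    by apply: leq_trans (size_map_subring_val _) _; exact: size_poly.
  apply: eq_bigr => i _; rewrite coef_map coef_poly ltn_ord.
  by case: insubP => [j _ ij|]; rewrite ?ltn_ord//; case: (c' j) => /= a ->;
    rewrite (val_inj ij).
move=> [p mp /rootP pz].
have p0 := monic_neq0 mp.
exists (size p).-1, (fun i => - subring_val p`_i); split=> [i|].
  by rewrite -rmorphN; exact: subring_val_in.
move/eqP: pz; rewrite horner_subring_val// (monicP mp) rmorph1 mul1r.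
rewrite addr_eq0 => /eqP ->; rewrite -sumrN; apply: eq_bigr => i _.
by rewrite mulNr.
Qed.

(** For [x] outside [A], maximality gives [1 / t] in [A[x]], so [x] is a root
    of some nonzero [q] over [A]. With [d] the leading coefficient of [q], the
    element [d x] is integral over [A]. Then so is every element of [A[d x]],
    and [1 / t] is not integral over [A], as an integral equation for it would
    put it in [A]. By maximality again [d x] is in [A]. *)
Lemma maximal_subring_fractions (t : K) : A t -> t != 0 -> ~ A t^-1 ->
    (forall C : set K, subring C -> A `<=` C -> ~ C t^-1 -> C `<=` A) ->
  forall x, exists2 b, A b /\ b != 0 & A (b * x).
Proof.
move=> At t0 AtV Amax x; have [A1 AB AM] := sA.
have A0 : A 0 by rewrite -(subrr 1); exact: AB.
have AN y : A y -> A (- y) by rewrite -sub0r; exact: AB.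
pose adj (y : K) : set K :=
  [set z | exists p : {poly subring_type}, z = (map_poly subring_val p).[y]].
have adjA y : A `<=` adj y.
  move=> z /subring_valP[a <-]; exists a%:P.
  by rewrite map_polyC hornerC.
have adjy y : adj y y by exists 'X; rewrite map_polyX hornerX.
have adjr y : subring (adj y).
  split; first exact: adjA.
    move=> _ _ [p ->] [q ->]; exists (p - q).
    by rewrite rmorphB hornerD hornerN.
  by move=> _ _ [p ->] [q ->]; exists (p * q); rewrite rmorphM hornerM.
have [Ax|Ax] := pselect (A x).
  by exists 1; rewrite ?mul1r//; split; rewrite ?oner_eq0.
have [p pE] : adj x t^-1.
  apply: contrapT => tx; apply: Ax.
  by apply: (Amax _ (adjr x)) => //; exact: adjA.
have [t' t'E] := subring_valP At.
(* The constant coefficient of [q] is nonzero, as [1 / t] is not in [A]. *)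
pose q := t' *: p - 1.
have qx : (map_poly subring_val q).[x] = 0.
  rewrite rmorphB rmorph1 hornerD hornerN hornerC /=.
  by rewrite map_polyZ hornerZ -pE /= t'E divff// subrr.
have q0 : q != 0.
  apply/eqP => q0; apply: AtV.
  have : q`_0 = 0 by rewrite q0 coef0.
  rewrite coefB coefZ coef1 /= => /eqP; rewrite subr_eq0 => /eqP tp.
  have := congr1 subring_val tp; rewrite rmorphM rmorph1 /= t'E => tp1.
  by rewrite -[t^-1]mulr1 -tp1 mulKf//; exact: subring_val_in.
pose n := (size q).-1; pose d := subring_val (lead_coef q).
have d0 : d != 0.
  rewrite /d; apply/eqP => d0; move: q0; rewrite -lead_coef_eq0 => /eqP; apply.
  by apply: val_inj; rewrite -[LHS]/(subring_val _) d0.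
have n0 : (0 < n)%N.
  rewrite /n -ltnS prednK ?size_poly_gt0//; rewrite ltnNge; apply/negP => q1.
  have := qx; rewrite (size1_polyC q1) map_polyC hornerC /=.
  move: d0; rewrite /d lead_coefE; case: (size q) q1 => [|[|]]//= _ /eqP d0 //.
have qE : d * x ^+ n = - \sum_(i < n) subring_val q`_i * x ^+ i.
  by move/eqP: qx; rewrite horner_subring_val// addr_eq0 => /eqP.
exists d; first by split => //; exact: subring_val_in.
have AX y k : A y -> A (y ^+ k).
  by move=> Ay; elim: k => [|k IH]; rewrite ?expr0 ?exprS//; exact: AM.
have Ad : A d by exact: subring_val_in.
have /integral_overP dx_int : integral_over (d * x).
  exists n, (fun i => - subring_val q`_i * d ^+ (n.-1 - i)); split=> [i|].
    by apply: AM; [exact/AN/subring_val_in|exact: AX].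
  rewrite exprMn -{1}(prednK n0) exprSr -mulrA qE mulrN mulr_sumr -sumrN.
  apply: eq_bigr => i _; rewrite !mulNr; congr (- _).
  have iE : d ^+ n.-1 = d ^+ (n.-1 - i) * d ^+ i.
    by rewrite -exprD subnK// -ltnS prednK.
  by rewrite iE exprMn mulrCA -!mulrA.
apply: (Amax _ (adjr (d * x)) (adjA _) _ _ (adjy _)).
move=> [r rE]; apply: AtV.
have /integral_overP[m [c [Ac tE]]] : integralOver subring_val t^-1.
  rewrite rE; apply: integral_horner => // z zr.
  have [i _ <-] : exists2 i, (i < size (map_poly subring_val r))%N &
      (map_poly subring_val r)`_i = z.
    by exists (index z (map_poly subring_val r)); rewrite ?index_mem ?nth_index.
  rewrite coef_map; exact: integral_id.
case: m c Ac tE => [|m] c Ac tE.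
  by move: tE; rewrite big_ord0 expr0 => /eqP; rewrite oner_eq0.
(* Multiply the integral equation by [t ^+ m]. *)
have -> : t^-1 = \sum_(i < m.+1) c i * t ^+ (m - i).
  have -> : t^-1 = t ^+ m * t^-1 ^+ m.+1.
    by rewrite exprS mulrCA -exprMn divff// expr1n mulr1.
  rewrite tE mulr_sumr; apply: eq_bigr => i _; rewrite mulrCA; congr (_ * _).
  have mE : t ^+ m = t ^+ (m - i) * t ^+ i by rewrite -exprD subnK// leq_ord.
  by rewrite mE -mulrA -exprMn divff// expr1n mulr1.
by apply: subring_sum => i; apply: AM => //; exact: AX.
Qed.

End SubringType.

Lemma subring_field_base (K : fieldType) (t : K) : t != 0 ->
  (forall p : {poly int}, t * (map_poly intr p).[t] != 1) ->
  exists2 B : set_system K, zero_base B & nondiscrete B.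
Proof.
move=> t0 tZ.
pose r (x y z : K) := z = x - y \/ z = x * y.
pose L := [set (map_poly intr p).[t] | p in [set: {poly int}]].
have subP (A : set K) : L `<=` A -> closed_under r A -> subring A.
  move=> LA clA; split.
  - by apply: LA; exists 1; rewrite // rmorph1 hornerC.
  - by move=> x y Ax Ay; apply: (clA x y) => //; left.
  - by move=> x y Ax Ay; apply: (clA x y) => //; right.
have clL : closed_under r L.
  move=> _ _ _ [->|->] [p _ <-] [q _ <-].
    by exists (p - q); rewrite // rmorphB hornerD hornerN.
  by exists (p * q); rewrite // rmorphM hornerM.
have LtV : ~ L t^-1.
  by move=> [p _ pE]; have := tZ p; rewrite pE divff// eqxx.
have [A [clA LA AtV Amax]] := maximal_closed_avoiding clL LtV.
have sA := subP _ LA clA.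
have At : A t by apply: LA; exists 'X; rewrite // map_polyX hornerX.
exists (ideal_base A); last exact: ideal_nondiscrete.
apply: (ideal_zero_base sA At t0 AtV).
apply: (maximal_subring_fractions sA At t0 AtV) => C [_ CB CM] AC.
by apply: Amax => // x y _ [->|->]; [exact: CB|exact: CM].
Qed.

(** * Nondiscrete ring topologies on countable fields *)

Lemma finite_roots (K : fieldType) (p : {poly K}) :
  p != 0 -> finite_set [set x | root p x].
Proof.
move=> p0; apply: contrapT => /(infinite_set_fset (size p))[X Xp].
rewrite leqNgt => /negP; apply; apply: max_poly_roots => //.
  by apply/allP => x xX; apply: Xp.
exact: fset_uniq.
Qed.

(** [stage c a d n] is the [d]-th approximation of the neighborhood [U n]: it is
    built from [a n], ..., [a (n + d - 1)], with the differences and products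
    of elements of the approximations of [U n.+1] and their multiples by [c j]
    for [j <= n]. The restriction on [j] keeps it finite, and every [c j] is
    still allowed from some [n] on. *)
Inductive stage (A : comPzRingType) (c a : nat -> A) :
  nat -> nat -> A -> Prop :=
| stage_0 d n : stage c a d n 0
| stage_gen d n : stage c a d.+1 n (a n)
| stage_sub d n x y : stage c a d n.+1 x -> stage c a d n.+1 y ->
    stage c a d.+1 n (x - y)
| stage_mul d n x y : stage c a d n.+1 x -> stage c a d n.+1 y ->
    stage c a d.+1 n (x * y)
| stage_scale d n j x : (j <= n)%N -> stage c a d n.+1 x ->
    stage c a d.+1 n (c j * x).

Section Stage.
Variables (A : comPzRingType) (c a : nat -> A).

Lemma stage_eq0 n x : stage c a 0 n x -> x = 0.
Proof. by move=> l; inversion l. Qed.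

Lemma stageS d n x : stage c a d n x -> stage c a d.+1 n x.
Proof.
elim=> {d n x}.
- by move=> d n; exact: stage_0.
- by move=> d n; exact: stage_gen.
- by move=> d n x y _ lx _ ly; exact: stage_sub.
- by move=> d n x y _ lx _ ly; exact: stage_mul.
- by move=> d n j x jn _ lx; exact: stage_scale.
Qed.

Lemma stage_leq d e n x : (d <= e)%N -> stage c a d n x -> stage c a e n x.
Proof.
by move=> /subnK <- lx; elim: (e - d)%N => //= k IH; rewrite addSn; exact: stageS.
Qed.

Lemma stage_incr d n x : stage c a d n.+1 x -> stage c a d.+1 n x.
Proof. by move=> lx; rewrite -[x]subr0; apply: stage_sub => //; exact: stage_0. Qed.

(** When the last generator is 0, the innermost stage, of depth 1, is reduced
    to 0 and can be replaced by the one of depth 0. *)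
Lemma stage_trim d n x : stage c a d n x ->
  forall e, d = e.+1 -> a (n + e)%N = 0 -> stage c a e n x.
Proof.
elim=> {d n x}.
- by move=> d n e _ _; exact: stage_0.
- move=> d n [|e] _; first by rewrite addn0 => ->; exact: stage_0.
  by move=> _; exact: stage_gen.
- move=> d n x y lx IHx ly IHy [|e] [de] ae0; rewrite {}de in lx ly IHx IHy *.
    by rewrite (stage_eq0 lx) (stage_eq0 ly) subr0; exact: stage_0.
  by apply: stage_sub; [apply: IHx|apply: IHy]; rewrite // addSnnS.
- move=> d n x y lx IHx ly IHy [|e] [de] ae0; rewrite {}de in lx ly IHx IHy *.
    by rewrite (stage_eq0 lx) mul0r; exact: stage_0.
  by apply: stage_mul; [apply: IHx|apply: IHy]; rewrite // addSnnS.
- move=> d n j x jn lx IHx [|e] [de] ae0; rewrite {}de in lx IHx *.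
    by rewrite (stage_eq0 lx) mulr0; exact: stage_0.
  by apply: stage_scale => //; apply: IHx; rewrite // addSnnS.
Qed.

Lemma finite_stage d n : finite_set [set x | stage c a d n x].
Proof.
elim: d n => [|d IH] n.
  by apply: sub_finite_set (finite_set1 0) => x /stage_eq0.
pose W := [set x | stage c a d n.+1 x].
apply: (@sub_finite_set _ _ ([set 0; a n] `|`
   ([set x - y | x in W & y in W] `|`
   ([set x * y | x in W & y in W] `|`
    \bigcup_(j in [set j | (j < n.+1)%N]) [set c j * x | x in W])))).
  move=> x /= lx; inversion lx; subst.
  - by left; left.
  - by left; right.
  - by right; left; exists x0 => //; exists y.
  - by right; right; left; exists x0 => //; exists y.
  - by right; right; right; exists j => //; exists x0.
rewrite finite_setU; split; first exact: finite_set2.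
rewrite finite_setU; split; first by apply: finite_image2; exact: IH.
rewrite finite_setU; split; first by apply: finite_image2; exact: IH.
apply: bigcup_finite; first exact: finite_II.
by move=> j _; apply: finite_image; exact: IH.
Qed.

End Stage.

Section StageMorphism.
Variables (A A' : comPzRingType) (h : {rmorphism A -> A'}).
Variables (c a : nat -> A) (c' a' : nat -> A').
Hypothesis hc : forall j, h (c j) = c' j.

Lemma stage_morph d n x : stage c a d n x ->
  (forall i, (i < n + d)%N -> h (a i) = a' i) -> stage c' a' d n (h x).
Proof.
elim=> {d n x}.
- by move=> d n _; rewrite rmorph0; exact: stage_0.
- by move=> d n ->; [exact: stage_gen|rewrite addnS ltnS leq_addr].
- move=> d n x y _ IHx _ IHy ha; rewrite rmorphB.
  by apply: stage_sub; [apply: IHx|apply: IHy]; rewrite addSnnS.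
- move=> d n x y _ IHx _ IHy ha; rewrite rmorphM.
  by apply: stage_mul; [apply: IHx|apply: IHy]; rewrite addSnnS.
- move=> d n j x jn _ IHx ha; rewrite rmorphM hc.
  by apply: stage_scale => //; apply: IHx; rewrite addSnnS.
Qed.

(** Elements built from the images of [c] and [a] are images of elements built
    in the same way; with an evaluation morphism for [h], they are values of
    polynomials. *)
Lemma stage_lift d n z : stage c' a' d n z ->
  (forall i, (i < n + d)%N -> h (a i) = a' i) ->
  exists2 x, stage c a d n x & z = h x.
Proof.
elim=> {d n z}.
- by move=> d n _; exists 0; [exact: stage_0|rewrite rmorph0].
- move=> d n ha; exists (a n); first exact: stage_gen.
  by rewrite ha// addnS ltnS leq_addr.
- move=> d n x y _ IHx _ IHy; rewrite -addSnnS => ha.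
  have [[x' lx ->] [y' ly ->]] := (IHx ha, IHy ha).
  by exists (x' - y'); rewrite ?rmorphB//; exact: stage_sub.
- move=> d n x y _ IHx _ IHy; rewrite -addSnnS => ha.
  have [[x' lx ->] [y' ly ->]] := (IHx ha, IHy ha).
  by exists (x' * y'); rewrite ?rmorphM//; exact: stage_mul.
- move=> d n j x jn _ IHx; rewrite -addSnnS => ha.
  have [x' lx ->] := IHx ha.
  by exists (c j * x'); rewrite ?rmorphM ?hc//; exact: stage_scale.
Qed.

End StageMorphism.

Section Countable.
Variables (K : fieldType) (c : nat -> K).
Hypothesis c_surj : forall x, exists n, c n = x.
Hypothesis K_inf : infinite_set [set: K].

(** The condition maintained while the sequence is built: the generators in
    [s] do not force the nonzero [c n] into [U n]. *)
Definition avoids (s : seq K) := forall n, (n <= size s)%N -> c n != 0 ->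
  ~ stage c (nth 0 s) (size s - n) n (c n).

(** Let the next generator be an indeterminate. An element [p] of a stage is
    then a polynomial, and its value at 0, where the new generator vanishes, was
    already obtained from [s], so it is not [c n]. Hence [p - c n] is a nonzero
    polynomial; finitely many of them have finitely many roots in all. *)
Lemma avoids_extend (s : seq K) : avoids s ->
  exists2 v, v != 0 & avoids (rcons s v).
Proof.
move=> av; pose k := size s.
(* [D] collects the roots to be avoided; the new generator has index [k]. *)
pose C j : {poly K} := (c j)%:P.
pose X i : {poly K} := if i == k then 'X else (nth 0 s i)%:P.
pose D := [set 0] `|` \bigcup_(n in [set n | (n < k.+1)%N /\ c n != 0])
  \bigcup_(p in [set p | stage C X (k.+1 - n) n p])
    [set v | root (p - (c n)%:P) v].
have finD : finite_set D.
  rewrite finite_setU; split; first exact: finite_set1.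
  apply: bigcup_finite.
    by apply: sub_finite_set (finite_II k.+1) => n [].
  move=> n /= [nk cn0]; apply: bigcup_finite; first exact: finite_stage.
  move=> p lp; apply: finite_roots; apply/eqP => pcn.
  apply: (av n) => //.
  have lc : stage c (nth 0 s) (k.+1 - n) n (horner_eval 0 p).
    apply: (stage_morph _ lp); first by move=> j; rewrite /= /horner_eval hornerC.
    move=> i _; rewrite /X /= /horner_eval; case: eqP => [->|_].
      by rewrite hornerX nth_default.
    by rewrite hornerC.
  have pE : horner_eval 0 p = c n.
    by move/eqP: pcn; rewrite subr_eq0 => /eqP ->; rewrite /horner_eval hornerC.
  rewrite pE subSn// in lc; apply: (stage_trim lc) => //.
  by rewrite subnKC// nth_default.
have [v Dv] : exists v, ~ D v.
  apply: contrapT => /forallNP Dall; apply: K_inf.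
  by apply: sub_finite_set finD => v _; apply: contrapT; exact: Dall.
exists v; first by apply/eqP => v0; apply: Dv; left.
move=> n; rewrite size_rcons leq_eqVlt => /predU1P[->|nk] cn0.
  by rewrite subnn => /stage_eq0/eqP; apply/negP.
move=> lc; apply: Dv; right; exists n => //.
have [||p lp cnE] := @stage_lift _ _ (horner_eval v) C X _ _ _ _ _ _ lc.
- by move=> j; rewrite /= /horner_eval hornerC.
- move=> i; rewrite (subnKC (ltnW nk)) => ik.
  rewrite /X /= /horner_eval nth_rcons.
  move: ik; rewrite ltnS leq_eqVlt => /predU1P[->|ik].
    by rewrite ltnn !eqxx hornerX.
  by rewrite ik (ltn_eqF ik) hornerC.
- exists p => //=; rewrite /root hornerD hornerN hornerC subr_eq0 cnE.
  exact/eqP.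
Qed.

Lemma countable_field_base_of_enum :
  exists2 B : set_system K, zero_base B & nondiscrete B.
Proof.
have /choice[step stepP] : forall s, exists v : K,
    avoids s -> v != 0 /\ avoids (rcons s v).
  move=> s; have [/avoids_extend[v v0 av]|nav] := pselect (avoids s).
    by exists v.
  by exists 0.
pose f k := iter k (fun s => rcons s (step s)) [::].
have szf k : size (f k) = k by elim: k => //= k IH; rewrite size_rcons IH.
have avf k : avoids (f k).
  elim: k => [|k IH]; last by have [] := stepP _ IH.
  by move=> n; rewrite leqn0 => /eqP -> cn0 /stage_eq0/eqP; apply/negP.
pose a i := step (f i).
have a0 i : a i != 0 by have [] := stepP _ (avf i).
have fa k i : (i < k)%N -> nth 0 (f k) i = a i.
  elim: k => // k IH; rewrite ltnS leq_eqVlt => /predU1P[->|ik] /=.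
    by rewrite nth_rcons szf ltnn eqxx.
  by rewrite nth_rcons szf ik IH.
pose U n := [set z | exists d, stage c a d n z].
(* An element of [U n] is in some stage, which involves the first [n + d]
   generators only. *)
have cnU n : c n != 0 -> ~ U n (c n).
  move=> cn0 [d lc]; have := @avf (n + d)%N n; rewrite szf leq_addr addKn.
  apply => //; apply: (@stage_morph _ _ idfun _ a) => // i ind.
  by rewrite fa.
have US n : U n.+1 `<=` U n.
  by move=> x [d lx]; exists d.+1; exact: stage_incr.
have Uleq m n : (m <= n)%N -> U n `<=` U m.
  move=> /subnK <-; elim: (n - m)%N => //= k IH.
  by apply: subset_trans IH; exact: US.
have U2 n x y : U n x -> U n y -> exists d, stage c a d n x /\ stage c a d n y.
  move=> [d lx] [e ly]; exists (maxn d e).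
  by split; [apply: stage_leq lx; exact: leq_maxl|
             apply: stage_leq ly; exact: leq_maxr].
have Uscale x V : range U V ->
    exists2 W, range U W & forall y, W y -> V (x * y).
  move=> [n _ <-]; have [j <-] := c_surj x.
  exists (U (maxn j n).+1); first by exists (maxn j n).+1.
  move=> y [d ly]; apply: (Uleq n (maxn j n)); first exact: leq_maxr.
  by exists d.+1; apply: stage_scale => //; exact: leq_maxl.
exists (range U); last first.
  by move=> _ [n _ <-]; exists (a n); [exists 1%N; exact: stage_gen|].
split.
- by exists (U 0); exists 0.
- move=> _ _ [m _ <-] [n _ <-]; exists (U (maxn m n)); first by exists (maxn m n).
  move=> x Ux; split; [apply: Uleq Ux; exact: leq_maxl|].
  by apply: Uleq Ux; exact: leq_maxr.
- by move=> _ [n _ <-]; exists 0; exact: stage_0.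
- move=> _ [n _ <-]; exists (U n.+1); first by exists n.+1.
  by move=> x y /U2/[apply]-[d [lx ly]]; exists d.+1; exact: stage_sub.
- move=> _ [n _ <-]; exists (U n.+1); first by exists n.+1.
  by move=> x y /U2/[apply]-[d [lx ly]]; exists d.+1; exact: stage_mul.
- exact: Uscale.
- move=> x V /(Uscale x)[W rW WV]; exists W => // y /WV; by rewrite mulrC.
- move=> x x0; have [n cnx] := c_surj x; exists (U n); first by exists n.
  by rewrite -cnx; apply: cnU; rewrite cnx.
Qed.

End Countable.

(** For each of the countably many integral polynomials [p], the equation
    [t p(t) = 1] has finitely many solutions. Hence, unless some [t <> 0]
    satisfies none of these equations, which is the case of a maximal subring,
    the field is countable. *)
Theorem infinite_field_base (K : fieldType) : infinite_set [set: K] ->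
  exists2 B : set_system K, zero_base B & nondiscrete B.
Proof.
move=> Kinf.
have [[t t0 tZ]|allZ] := pselect (exists2 t : K, t != 0 &
    forall p : {poly int}, t * (map_poly intr p).[t] != 1).
  exact: subring_field_base t0 tZ.
have cK : countable [set: K].
  pose F (p : {poly int}) : set K :=
    [set 0] `|` [set t | t * (map_poly intr p).[t] = 1].
  have -> : [set: K] = \bigcup_p F p.
    apply/seteqP; split=> // t _.
    have [->|t0] := eqVneq t 0; first by exists 0 => //; left.
    apply: contrapT => tF; apply: allZ; exists t => // p.
    by apply/eqP => tp; apply: tF; exists p => //; right.
  apply: bigcup_countable => [|p _]; first exact: countableP.
  apply: finite_set_countable; rewrite finite_setU; split.
    exact: finite_set1.
  apply: (@sub_finite_set _ _ [set x | root ('X * map_poly intr p - 1) x]).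
    by move=> t /= tp; rewrite /root !hornerE/= tp subrr.
  apply: finite_roots; apply/eqP => /(congr1 (fun q : {poly K} => q.[0])).
  by rewrite !hornerE /= => /eqP; rewrite oppr_eq0 oner_eq0.
have /countable_injP[g ginj] := cK.
have /choice[c cP] : forall n, exists x : K, (exists y, g y = n) -> g x = n.
  move=> n; have [[y yn]|ny] := pselect (exists y, g y = n); first by exists y.
  by exists 0.
apply: (@countable_field_base_of_enum _ c) => // x; exists (g x).
by apply: ginj; rewrite ?inE//; apply: cP; exists x.
Qed.

(** * Finite-dimensional spaces over infinite fields *)

Lemma finite_row_vectors (K : fieldType) n :
  finite_set [set: K] -> finite_set [set: 'rV[K]_n].
Proof.
move=> finK; elim: n => [|n IH].
  by apply: sub_finite_set (finite_set1 0) => v _; rewrite /= [v]thinmx0.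
apply: (@sub_finite_set _ _
  [set (row_mx c%:M v : 'rV_(1 + n)) | c in [set: K] & v in [set: 'rV[K]_n]]).
  move=> v _; exists ((v : 'rV_(1 + n)) 0 0) => //.
  exists (rsubmx (v : 'rV_(1 + n))) => //.
  rewrite -[RHS](@hsubmxK _ 1 1 n); congr row_mx.
  by rewrite [RHS]mx11_scalar mxE; congr (_ %:M); congr (v _ _); exact: val_inj.
exact: finite_image2.
Qed.

Section Matrices.
Variables (R : comPzRingType) (M : lmodType R) (K : fieldType).
Variable s : lmod_structure K M.
Local Notation V := (lmod_of s).
Local Notation E := (endo M).
Hypothesis linE : forall f : M -> M, linear f <-> linear (f : V -> V).
Variables (n : nat) (v2r : V -> 'rV[K]_n) (r2v : 'rV[K]_n -> V).
Hypothesis v2r_linear : linear v2r.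
Hypothesis v2rK : cancel v2r r2v.
Hypothesis r2vK : cancel r2v v2r.

Lemma r2v_linear : linear r2v.
Proof. by move=> c x y; rewrite -{1}[x]r2vK -{1}[y]r2vK -v2r_linear v2rK. Qed.

Definition coord_endo (a : E) (u : 'rV[K]_n) : 'rV[K]_n :=
  v2r (endo_fun a (r2v u)).

Lemma coord_endo_linear a : linear (coord_endo a).
Proof.
move=> c x y; rewrite /coord_endo r2v_linear.
by have /linE -> := linearP a : linear (endo_fun a); rewrite v2r_linear.
Qed.

HB.instance Definition _ a := GRing.isLinear.Build K _ _ _ (coord_endo a)
  (coord_endo_linear a).

(** [lin1_mx] is the matrix of an action on row vectors; the transpose turns
    the composition of endomorphisms into the product of matrices in the same
    order. *)
Definition endo_matrix (a : E) : 'M[K]_n := (lin1_mx (coord_endo a))^T.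

Lemma endo_matrixP a u : u *m (endo_matrix a)^T = coord_endo a u.
Proof. by rewrite trmxK mul_rV_lin1. Qed.

Lemma endo_matrix_eq a (A : 'M[K]_n) :
  (forall u, u *m A^T = coord_endo a u) -> endo_matrix a = A.
Proof.
move=> uA; apply: trmx_inj; apply/row_matrixP => i.
by rewrite !rowE endo_matrixP uA.
Qed.

Lemma endo_matrixD : {morph endo_matrix : a b / a + b}.
Proof.
move=> a b; apply: endo_matrix_eq => u; rewrite linearD mulmxDr !endo_matrixP.
rewrite /coord_endo -[v2r _ in LHS]scale1r -v2r_linear scale1r.
by [].
Qed.

Lemma endo_matrixM : {morph endo_matrix : a b / endo_mul a b >-> a *m b}.
Proof.
move=> a b; apply: endo_matrix_eq => u.
by rewrite trmx_mul mulmxA !endo_matrixP /coord_endo v2rK.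
Qed.

Lemma endo_matrix_inj a : endo_matrix a = 0 -> a = 0.
Proof.
move=> a0; apply: endoP => m.
have r2v0 : r2v 0 = 0.
  have v2r0 : v2r 0 = 0.
    have := v2r_linear (-1) 0 0.
    by rewrite !scaleN1r oppr0 addr0 addNr.
  by rewrite -v2r0 v2rK.
have := endo_matrixP a (v2r m); rewrite a0 trmx0 mulmx0 /coord_endo v2rK => e0.
by rewrite -[LHS]v2rK -e0 r2v0.
Qed.

Lemma endo_matrix_surj A : exists a, endo_matrix a = A.
Proof.
have [|a aE] := @endo_exists _ _ _ _ linE (fun x => r2v (v2r x *m A^T)).
  by move=> c x y; rewrite v2r_linear mulmxDl -scalemxAl r2v_linear.
by exists a; apply: endo_matrix_eq => u; rewrite /coord_endo aE !r2vK.
Qed.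

Lemma endo_discrete : nbhs (0 : E) [set a | a = 0].
Proof.
apply/nbhs0_endoP; exists [seq r2v (delta_mx 0 i) | i : 'I_n] => a a0.
apply: endo_matrix_inj; apply: trmx_inj; apply/row_matrixP => i.
rewrite rowE endo_matrixP /coord_endo a0 ?trmx0 ?row0; last first.
  by apply/mapP; exists i; rewrite ?mem_enum.
have := v2r_linear (-1) 0 0.
by rewrite !scaleN1r oppr0 addr0 addNr.
Qed.

(** In finite dimension an endomorphism is determined by its values on a basis,
    so [E] is discrete and every homomorphism from it is continuous. The
    isomorphism with a nondiscrete ring of matrices is not a homeomorphism. *)
Lemma not_completely_simple_endo : infinite_set [set: M] ->
  ~ completely_simple E.
Proof.
move=> Minf [[b [c bc0]] simple].
have Kinf : infinite_set [set: K].
  move=> /(@finite_row_vectors _ n)/(finite_image r2v) finM; apply: Minf.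
  by apply: sub_finite_set finM => m _; exists (v2r m).
have [B hB ndB] := infinite_field_base Kinf.
pose S : topRingType := base_ring (matrix_zero_base hB n).
pose f : E -> S := endo_matrix.
have fhom : ring_hom f by split=> x y; [exact: endo_matrixD|exact: endo_matrixM].
have fcont : continuous f.
  apply: morph_add_continuous; first by case: fhom.
  move=> U U0; apply: filterS endo_discrete => a /= ->.
  by rewrite (morph_add0 fhom.1); exact: nbhs_singleton.
have finj : injective f.
  move=> x y fxy; apply/eqP; rewrite -subr_eq0; apply/eqP/endo_matrix_inj.
  by rewrite -[LHS]/(f (x - y)) (morph_addB fhom.1) fxy subrr.
have [f0|/(homeo_onto_imageP fhom.1 finj fcont)] := simple S f fhom fcont.
  by move/eqP: bc0; apply; apply: endo_matrix_inj; exact: f0.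
move=> /(_ _ endo_discrete)[W [_ [U BU <-] UW] Wf].
have [u Uu u0] := ndB U BU.
have [a aE] := endo_matrix_surj (const_mx u).
have a0 : a = 0.
  apply: Wf; apply: UW => i j /=; rewrite -[f a]/(endo_matrix a) aE.
  by rewrite subr0 mxE.
(* The dimension is not 0, since [E] is not the zero ring. *)
have [j] : exists j : 'I_n, True.
  apply: contrapT => no_index; move/eqP: bc0; apply; apply: endo_matrix_inj.
  by apply/matrixP => j; case: no_index; exists j.
rewrite a0 in aE; have u_eq0 : const_mx u = 0 :> 'M[K]_n.
  by rewrite -aE; exact: morph_add0 fhom.1.
by move/matrixP/(_ j j): u_eq0; rewrite !mxE; move/eqP: u0.
Qed.

End Matrices.

(** * Characterization of complete simplicity *)

Theorem theorem9 (R : comPzRingType) (M : lmodType R) :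
  completely_simple (endo M) <->
  exists (pP : prime_ideal (module_annihilator M))
         (s : lmod_structure (residue_field pP) M),
    [/\ forall (r : R) (m : M),
          to_residue_field pP r *: (m : lmod_of s) = r *: m,
        forall f : M -> M,
          linear f <-> linear (f : lmod_of s -> lmod_of s) &
        finite_set [set: M] \/
        (infinite_set [set: M] /\ ~ finite_dimensional (lmod_of s))].
Proof.
split=> [simple|[pP [s [_ linE finM]]]]; last first.
  apply: (completely_simple_endo linE); last by case: finM => [|[]]; [left|right].
  apply: contrapT => M0; apply: (pideal1 pP) => m; apply/eqP.
  by apply/negPn/negP => m0; apply: M0; exists m; rewrite scale1r in m0.
have pP := annihilator_prime simple.
have div_inj := nonannihilator_inj simple.
have div_surj := nonannihilator_surj simple.
exists pP, (fraction_structure pP div_inj div_surj); split.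
- exact: fraction_structureE.
- exact: fraction_structure_linear.
have [finM|infM] := pselect (finite_set [set: M]); [by left|right; split => //].
move=> [n [[v2r v2r_linear [r2v v2rK r2vK]]]].
exact: (not_completely_simple_endo
  (fraction_structure_linear pP div_inj div_surj)
  v2r_linear v2rK r2vK infM simple).
Qed.
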